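(* Let $n\ge 2$, $d\ge 1$, $k\ge 0$ be integers. Let $\nu_{n,d}(k)$ be the number of linearly independent homogeneous invariants of degree $k$ of the $n$-ary form of degree $d$, i.e. $\nu_{n,d}(k)=\dim_{\mathbb{C}}\,(A_{n,d}^{SL_n})_k$. Then $$\nu_{n,d}(k)=\sum_{s\in W}(-1)^{|s|}\,c_{n,d}\bigl(k,(\rho-s(\rho))^*\bigr).$$
   Context: **Forms and invariants.** Let $I_{n,d}=\{i=(i_1,\dots,i_{n-1})\in\mathbb{Z}_{\ge 0}^{n-1} : |i|\le d\}$, where $|i|=i_1+\cdots+i_{n-1}$. Let $F_{d,n}$ be the $\mathbb{C}$-vector space of $n$-ary forms of degree $d$, $$\sum_{i\in I_{n,d}} a_i\binom{d}{i}x_1^{d-|i|}x_2^{i_1}\cdots x_n^{i_{n-1}},\qquad \binom{d}{i}=\frac{d!}{i_1!\cdots i_{n-1}!\,(d-|i|)!},\quad a_i\in\mathbb{C}.$$ The algebra of polynomial functions $\mathbb{C}[F_{d,n}]$ is identified with the polynomial algebra $A_{n,d}=\mathbb{C}[a_i : i\in I_{n,d}]$. The natural action of $SL_n=SL_n(\mathbb{C})$ on $F_{d,n}$ by linear change of variables induces an action on $A_{n,d}$. The ring of invariants $A_{n,d}^{SL_n}$ is graded by total degree in the $a_i$, and $(A_{n,d}^{SL_n})_k$ denotes its degree $k$ component. **Weights and Weyl group.** Integral weights of the Lie algebra $\mathfrak{sl}_n$ are written as tuples $\lambda=(\lambda_1,\dots,\lambda_{n-1})\in\mathbb{Z}^{n-1}$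 of their coordinates with respect to the fundamental weights. A weight is dominant if all $\lambda_s\ge 0$. $W$ is the Weyl group of $\mathfrak{sl}_n$ (isomorphic to the symmetric group $S_n$), acting on weights in the usual way: it is generated by the simple reflections $\lambda\mapsto\lambda-\lambda_j\alpha_j$ ($1\le j\le n-1$), where $\alpha_j$ is the $j$-th simple root, written in the same coordinates, i.e. the $j$-th row of the Cartan matrix of type $A_{n-1}$. For $s\in W$, $(-1)^{|s|}$ is the sign of $s$ (the determinant of $s$; equal to $-1$ on reflections). $\rho=(1,1,\dots,1)$ is half the sum of the positive roots. For a weight $\lambda$, $\lambda^*$ denotes the unique dominant weight in the orbit $W(\lambda)$. **The numbers $c_{n,d}$.** For $\mu=(\mu_1,\dots,\mu_{n-1})\in\mathbb{Z}^{n-1}$, $c_{n,d}(k,\mu)$ is the number of families $\alpha=(\alpha_i)_{i\in I_{n,d}}$ of nonnegative integers satisfying $$2\,\omega_1(\alpha)+\omega_2(\alpha)+\cdots+\omega_{n-1}(\alpha)=kd-\mu_1,$$ $$\omega_{r-1}(\alpha)-\omega_{r}(\alpha)=\mu_{r}\quad (2\le r\le n-1),\qquad |\alpha|:=\sum_{i\in I_{n,d}}\alpha_i=k,$$ where $\omega_r(\alpha)=\sum_{i\in I_{n,d}}i_r\,\alpha_i$ for $1\le r\le n-1$. *)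

(* Defs.v *)
From HB Require Import structures.
From mathcomp Require Import all_boot all_order all_algebra.
From mathcomp Require Import boolp classical_sets functions cardinality fsbigop.
From mathcomp Require Import fingroup perm reals complex.
From mathcomp Require Import mpoly.

Set Implicit Arguments.
Unset Strict Implicit.
Unset Printing Implicit Defensive.

Import GRing.Theory.
Local Open Scope ring_scope.

(* Multi-indices i = (i_1, ..., i_{n-1}) with |i| <= d; the coordinate i_r
   (1 <= r <= n-1) is [i (r-1)], and |i| is [mdeg i]. *)
Definition Ind (n d : nat) : finType := 'X_{1..n.-1 < d.+1}.

Section Forms.
Variables (R : realType) (n d : nat).
Local Notation C := R[i].

(* The exponent of x_1^(d-|i|) x_2^(i_1) ... x_n^(i_(n-1)). *)
Definition form_mon (i : Ind n d) : 'X_{1..n} :=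
  [multinom nth 0%N ((d - mdeg i)%N :: multinom_val i) r | r < n].

Definition multibin (i : Ind n d) : C :=
  d`!%:R / ((\prod_r (i r)`!)%N * (d - mdeg i)`!)%:R.

Definition form (a : Ind n d -> C) : {mpoly C[n]} :=
  \sum_i (a i * multibin i) *: 'X_[form_mon i].

Definition form_coef (f : {mpoly C[n]}) (i : Ind n d) : C :=
  f@_(form_mon i) / multibin i.

(* (g . f)(x) = f(x g), for x a row of variables. *)
Definition change_vars (g : 'M[C]_n) (f : {mpoly C[n]}) : {mpoly C[n]} :=
  f \mPo [tuple \sum_l g l j *: 'X_l | j < n].

(* The number of variables of A_{n,d} is written as a successor because the
   vector space structure on [dhomog] requires it. *)
Definition ncoef : nat := #|Ind n d|.-1.+1.

Lemma ncoefE : ncoef = #|Ind n d|.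
Proof.
rewrite /ncoef prednK //; apply/card_gt0P.
have lt0d : (mdeg (@mnm0 n.-1) < d.+1)%N by rewrite mdeg0.
by exists (BMultinom lt0d).
Qed.

Definition coef_ind (j : 'I_ncoef) : Ind n d := enum_val (cast_ord ncoefE j).

(* The value of P in A_{n,d} at the form with coefficients a. *)
Definition value (P : {mpoly C[ncoef]}) (a : Ind n d -> C) : C :=
  P.@[fun j => a (coef_ind j)].

(* Invariance under the action on A_{n,d}, seen as the algebra of polynomial
   functions on forms, induced by the action of SL_n on forms. *)
Definition is_invariant (P : {mpoly C[ncoef]}) : Prop :=
  forall g : 'M[C]_n, \det g = 1 ->
  forall a : Ind n d -> C,
    value P (form_coef (change_vars g (form a))) = value P a.

Lemma multibin_neq0 i : multibin i != 0.
Proof.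
apply: mulf_neq0; rewrite ?invr_eq0 Num.Theory.pnatr_eq0.
  by rewrite -lt0n fact_gt0.
by rewrite -lt0n muln_gt0 fact_gt0 andbT prodn_gt0 // => r; rewrite fact_gt0.
Qed.

End Forms.

Lemma form_mon_inj n d : (0 < n)%N -> injective (@form_mon n d).
Proof.
case: n => // n _ i j /mnmP eq_ij; apply: val_inj => /=; apply/mnmP => r.
by have := eq_ij (lift ord0 r); rewrite !mnmE /= !(mnm_nth 0%N).
Qed.

Lemma form_mon_onto n d (m : 'X_{1..n}) :
  (0 < n)%N -> mdeg m = d -> exists i : Ind n d, form_mon i = m.
Proof.
case: n m => // n m _ mdeg_m.
pose m' : 'X_{1..n} := [multinom m (lift ord0 r) | r < n].
have mdegE : mdeg m = (m ord0 + mdeg m')%N.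
  rewrite !mdegE big_ord_recl; congr (_ + _)%N.
  by apply: eq_bigr => r _; rewrite mnmE.
have lt_m' : (mdeg m' < d.+1)%N by rewrite ltnS -mdeg_m mdegE leq_addl.
exists (BMultinom lt_m'); apply/mnmP => r; rewrite mnmE /=.
case: (unliftP ord0 r) => [t ->|->] /=.
  by rewrite -(mnm_nth 0%N m') mnmE.
by rewrite -mdeg_m mdegE addnK.
Qed.

Lemma mdeg_form_mon n d (i : Ind n d) : (0 < n)%N -> mdeg (form_mon i) = d.
Proof.
case: n i => // n i _; rewrite mdegE big_ord_recl mnmE /=.
under eq_bigr do rewrite mnmE /= -(mnm_nth 0%N).
by rewrite -mdegE subnK // -ltnS bmdeg.
Qed.

(* The forms [form a] are exactly the homogeneous polynomials of degree d,
   with [form_coef] giving the coefficients a_i. *)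
Lemma form_homog (R : realType) n d (a : Ind n d -> R[i]) :
  (0 < n)%N -> form a \is d.-homog.
Proof.
move=> n0; apply: rpred_sum => i _; apply: rpredZ.
by rewrite dhomogX; apply/eqP/(mdeg_form_mon i n0).
Qed.

Lemma formK (R : realType) n d (a : Ind n d -> R[i]) (i : Ind n d) :
  (0 < n)%N -> form_coef (form a) i = a i.
Proof.
move=> n0; rewrite /form_coef /form raddf_sum (bigD1 i) //= big1 => [|j nji].
  by rewrite mcoeffZ mcoeffX eqxx mulr1 addr0 mulfK // multibin_neq0.
by rewrite mcoeffZ mcoeffX (inj_eq (form_mon_inj n0)) (negbTE nji) mulr0.
Qed.

Lemma form_coefK (R : realType) n d (f : {mpoly R[i][n]}) :
  (0 < n)%N -> f \is d.-homog -> form (@form_coef R n d f) = f.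
Proof.
move=> n0 homf; apply/mpolyP => m.
have [mdeg_m|nmdeg_m] := eqVneq (mdeg m) d; last first.
  by rewrite !(dhomog_nemf_coeff _ nmdeg_m) // form_homog.
have [i <-] := form_mon_onto n0 mdeg_m.
rewrite -[LHS](divfK (multibin_neq0 R i)).
by rewrite -[X in X * _]/(form_coef _ i) formK // divfK // multibin_neq0.
Qed.

(* A subset of a finite-dimensional space that is closed under linear
   combinations is, classically, a subspace in the sense of [vspace]. *)
Lemma submod_vspace (K : fieldType) (V : vectType K) (P : V -> Prop) :
  P 0 -> (forall c u v, P u -> P v -> P (c *: u + v)) ->
  exists U : {vspace V}, forall v, v \in U <-> P v.
Proof.
move=> P0 PZD.
have ext m (U : {vspace V}) : (\dim {:V} - \dim U <= m)%N ->
    (forall v, v \in U -> P v) ->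
    exists U' : {vspace V}, forall v, v \in U' <-> P v.
  elim: m U => [|m IH] U leUm PU.
    exists U => v; split; first exact: PU.
    have /eqP -> : U == fullv.
      by rewrite eqEdim subvf /= -subn_eq0 -leqn0.
    by rewrite memvf.
  have [[v [Pv nUv]]|noV] := pselect (exists v, P v /\ v \notin U).
    apply: (IH (U + <[v]>)%VS).
      have ltU : (\dim U < \dim (U + <[v]>))%N.
        rewrite ltnNge; apply: contra nUv => le.
        have /eqP -> : U == (U + <[v]>)%VS by rewrite eqEdim addvSl.
        by rewrite memvE addvSr.
      have := dimvS (subvf (U + <[v]>)).
      rewrite leq_subLR in leUm => ?.
      rewrite leq_subLR (leq_trans leUm) // addnS -addSn.
      by rewrite leq_add2r.
    move=> w /memv_addP [u Uu [w' /vlineP [c ->] ->]].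
    by rewrite addrC; apply: PZD => //; apply: PU.
  exists U => v; split; first exact: PU.
  by move=> Pv; apply/negPn/negP => nUv; apply: noV; exists v.
apply: (ext _ 0%VS (leqnn _)) => v.
by rewrite memv0 => /eqP ->.
Qed.

Lemma invariants_ex (R : realType) (n d k : nat) :
  exists U : {vspace dhomog (ncoef n d) R[i] k},
    forall P, P \in U <-> is_invariant P.
Proof.
apply: submod_vspace => [g _ a|c P Q invP invQ g detg a].
  by rewrite /value !meval0.
by rewrite /value !mevalD !mevalZ; congr (_ * _ + _); [apply: invP|apply: invQ].
Qed.

(* (A_{n,d}^SL_n)_k; its elements are characterized by [invariantsP]. *)
Definition invariants (R : realType) (n d k : nat) :
    {vspace dhomog (ncoef n d) R[i] k} :=
  sval (cid (invariants_ex R n d k)).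

Lemma invariantsP (R : realType) (n d k : nat)
    (P : dhomog (ncoef n d) R[i] k) :
  P \in invariants R n d k <-> is_invariant P.
Proof. exact: (svalP (cid (invariants_ex R n d k))). Qed.

Definition nu (R : realType) (n d k : nat) : nat := \dim (invariants R n d k).

Section Weights.
Variable n : nat.

(* Coordinates with respect to the fundamental weights. *)
Definition weight : Type := 'rV[int]_n.-1.

Definition cartan : 'M[int]_n.-1 :=
  \matrix_(i, j) (if i == j then 2
                  else if (i.+1 == j :> nat) || (j.+1 == i :> nat) then -1
                  else 0).

Definition simple_root (j : 'I_n.-1) : weight := row j cartan.

(* Linear maps are matrices acting on row vectors from the right. *)
Definition simple_reflection (j : 'I_n.-1) : 'M[int]_n.-1 :=
  1%:M - delta_mx j j *m cartan.

Lemma simple_reflectionE (lam : weight) (j : 'I_n.-1) :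
  lam *m simple_reflection j = lam - lam 0 j *: simple_root j.
Proof.
rewrite mulmxBr mulmx1 mulmxA; congr (_ - _).
apply/rowP => l; rewrite !mxE (bigD1 j) //= big1 => [|r nrj].
  rewrite addr0 !mxE (bigD1 j) //= big1 => [|r nrj].
    by rewrite !mxE !eqxx mulr1 addr0.
  by rewrite !mxE (negbTE nrj) mulr0.
rewrite mxE big1 ?mul0r // => q _.
by rewrite !mxE (negbTE nrj) andbF mulr0.
Qed.

(* Simple reflections are involutions, so the monoid they generate is the
   group they generate. *)
Inductive in_weyl : 'M[int]_n.-1 -> Prop :=
| in_weyl1 : in_weyl 1%:M
| in_weylM j s : in_weyl s -> in_weyl (simple_reflection j *m s).

Definition weyl : set 'M[int]_n.-1 := [set s | in_weyl s]%classic.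

(* Weights in the coordinates x_1, ..., x_n of the diagonal matrices are
   mapped to fundamental coordinates by x |-> (x_r - x_(r+1))_r. *)
Definition eps_mx : 'M[int]_(n, n.-1) :=
  \matrix_(i, j) ((i == j :> nat)%:R - (i == j.+1 :> nat)%:R).

Lemma weyl_perm s : weyl s ->
  exists p : 'S_n, perm_mx p *m eps_mx = eps_mx *m s.
Proof.
elim=> [|j t _ [p eqp]]; first by exists 1%g; rewrite perm_mx1 mul1mx mulmx1.
have ltj : (j < n)%N by apply: leq_trans (ltn_ord j) (leq_pred n).
have ltj1 : (j.+1 < n)%N by rewrite -ltn_predRL.
pose a := Ordinal ltj; pose b := Ordinal ltj1.
exists (tperm a b * p)%g; rewrite perm_mxM -mulmxA eqp !mulmxA; congr (_ *m _).
apply/row_matrixP => i; rewrite !row_mul simple_reflectionE.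
apply/rowP => l; rewrite -row_mul -row_permE !mxE.
have -> : (i == j :> nat) = (i == a) by [].
have -> : (i == j.+1 :> nat) = (i == b) by [].
have ab : (a == b) = false by rewrite -val_eqE /= ltn_eqF.
have ba : (b == a) = false by rewrite eq_sym.
case: tpermP => [->|->|/eqP/negbTE -> /eqP/negbTE ->];
  rewrite ?subrr ?mul0r ?subr0 // ?eqxx ?ab ?ba -?[j == l]val_eqE /= ?eqSS;
  case: (ltngtP j l) => [lt_jl|lt_lj|->];
  rewrite ?eqxx ?(ltn_eqF (ltnSn _)) ?(gtn_eqF (ltnSn _)) // [l.+1 == j]eq_sym;
  case E1: (j.+1 == l); case E2: (j == l.+1 :> nat) => //=;
  by [move: lt_jl; rewrite (eqP E2) ltnNge leqnSn
     |move: lt_lj; rewrite -(eqP E1) ltnNge leqnSn].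
Qed.

Lemma eps_mx_inj (s t : 'M[int]_n.-1) : eps_mx *m s = eps_mx *m t -> s = t.
Proof.
pose P : 'M[int]_(n.-1, n) := \matrix_(j, i) (i <= j)%N%:R.
suff PE : P *m eps_mx = 1%:M.
  by move=> /(congr1 (mulmx P)); rewrite !mulmxA PE !mul1mx.
apply/matrixP => j l; rewrite !mxE.
have ltl : (l < n)%N by apply: leq_trans (ltn_ord l) (leq_pred n).
have ltl1 : (l.+1 < n)%N by rewrite -ltn_predRL.
under eq_bigr do rewrite !mxE mulrBr.
rewrite sumrB (bigD1 (Ordinal ltl)) //= [X in _ - X](bigD1 (Ordinal ltl1)) //=.
rewrite !big1 => [|i|i]; rewrite -?val_eqE; try by move/negbTE=> /= ->; rewrite mulr0.
by rewrite /= !eqxx !mulr1 !addr0; case: (ltngtP j l).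
Qed.

Lemma finite_weyl : finite_set weyl.
Proof.
pose f (p : 'S_n) : 'M[int]_n.-1 :=
  xget 1%:M [set s | perm_mx p *m eps_mx = eps_mx *m s]%classic.
apply: (sub_finite_set (B := (f @` setT)%classic)); last first.
  by apply: finite_image; exact: finite_finset.
move=> s /weyl_perm [p eqp]; exists p => //.
by apply: xget_unique => // t /=; rewrite eqp => /eps_mx_inj.
Qed.

Definition rho : weight := const_mx 1.

Definition dominant (lam : weight) : Prop := forall j, 0 <= lam 0 j.

(* lam^*; the default value 0 is never used, since every orbit contains a
   (unique) dominant weight. *)
Definition dominant_rep (lam : weight) : weight :=
  xget 0 [set mu : weight | dominant mu /\
                            exists2 s, weyl s & mu = lam *m s]%classic.

End Weights.
Arguments weyl : clear implicits.

Section Count.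
Variables (n d : nat).

Definition omega k (al : {ffun Ind n d -> 'I_k.+1}) (r : 'I_n.-1) : nat :=
  (\sum_(i : Ind n d) i r * al i)%N.

(* The entries of a family of total k are at most k, so that such families
   live in a finite type. Indices are shifted: omega_r and mu_r, for
   1 <= r <= n-1, are here [omega al (r-1)] and [mu 0 (r-1)]. *)
Definition c_num (k : nat) (mu : weight n) : nat :=
  #|[set al : {ffun Ind n d -> 'I_k.+1} |
      [&& [forall r : 'I_n.-1, (r == 0%N :> nat) ==>
            ((2 * omega al r + \sum_(t < n.-1 | (0 < t)%N) omega al t)%N%:Z
               == (k * d)%N%:Z - mu 0 r)],
          [forall r : 'I_n.-1, forall t : 'I_n.-1, (t == r.+1 :> nat) ==>
            ((omega al r)%:Z - (omega al t)%:Z == mu 0 t)]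
        & (\sum_i al i == k)%N]]|.

End Count.
Arguments c_num : clear implicits.

(* Main.v *)
From HB Require Import structures.
Require Import Defs.
From mathcomp Require Import all_boot all_order all_algebra.
From mathcomp Require Import boolp classical_sets functions cardinality fsbigop.
From mathcomp Require Import reals complex.
From mathcomp Require Import fingroup perm.
From mathcomp Require Import mpoly.
From mathcomp Require Import ring zify.
Set Implicit Arguments.
Unset Strict Implicit.
Unset Printing Implicit Defensive.
Import Order.TTheory GRing.Theory Num.Theory.
Local Open Scope ring_scope.

(** Let V be the degree k part of the algebra of coefficients of forms. It is a
    representation of gl_n: the operators x_j d/dx_i on forms induce derivations
    of the algebra (called polarizations). The monomials are weight vectors, and
    they are indexed by the families alpha that c_{n,d} counts; so c_{n,d}(k, mu)
    is the multiplicity of the weight mu in V.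

    An element P of V is invariant under SL_n if and only if the polarizations
    with i <> j annihilate it. Indeed, along a one-parameter group of
    transvections P is a polynomial in the parameter, its derivative is given by
    a polarization ([deriv_curve]), and transvections generate SL_n
    ([transvection_ind]).

    That the dimension of the space of invariants is an alternating sum of weight
    multiplicities ([invariant_rank]) is Weyl's character formula for the powers
    of the determinant. It is proved by taking traces. For Z commuting with gl_n
    let chi_Z be the generating function of the traces of Z on the weight spaces,
    and let D be the Vandermonde determinant. Since traces are invariant under
    cyclic permutation, the Casimir element C satisfies a differential equation
    ([laplace_weight_trace]): the Laplacian of D chi_Z is D chi_ZC plus a constant
    multiple of D chi_Z. Suppose that k d = n m. Comparing the coefficients at
    rho + (m, ..., m), one finds that the functional sending Z to this coefficient
    of D chi_Z vanishes on the multiples of S = C - n m^2. Now S is the Casimir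
    element of V twisted by det^(-m). For the Fischer form, where the action of
    E_ij is adjoint to that of E_ji, it is self-adjoint and positive, and its
    kernel consists of the invariants. Hence the projector onto the invariants is
    a polynomial in S, and the functional takes the same value at the projector as
    at 1. At the projector this value is the dimension of the space of
    invariants, because invariants have weight (m, ..., m). At 1 it is the sum
    over the permutations p of the sign of p times the multiplicity of
    rho + (m, ..., m) - p rho.

    Finally, the Weyl group is identified with the symmetric group through its
    action on the weights of gl_n ([weyl_sum]). Permutations of the variables show
    that weight multiplicities are constant on its orbits, so that a weight may be
    replaced by the dominant weight in its orbit ([c_num_dominant]). If n does not
    divide k d, then there are neither invariants nor families with a weight in
    the root lattice, and both sides vanish. *)

(** * Derivations of polynomial rings *)

Lemma mpoly_alg_ind (K : comNzRingType) (n : nat) (T : {mpoly K[n]} -> Prop) :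
  (forall c, T c%:MP) -> (forall i, T 'X_i) ->
  (forall P Q, T P -> T Q -> T (P + Q)) ->
  (forall P Q, T P -> T Q -> T (P * Q)) ->
  forall P, T P.
Proof.
move=> TC TX TD TM; elim/mpolyind => [|c m P _ _ TP]; first by rewrite -mpolyC0.
have TX' m' : T 'X_[m'].
  rewrite mpolyXE_id; elim/big_rec: _ => [|i Q _ TQ]; first by rewrite -mpolyC1.
  apply: (TM) TQ; elim: (m' i) => [|j IH]; first by rewrite expr0 -mpolyC1.
  by rewrite exprS; apply: (TM).
by apply: (TD) TP; rewrite -mul_mpolyC; apply: (TM).
Qed.

Lemma mderivXU (K : comNzRingType) (n : nat) (i j : 'I_n) :
  ('X_j : {mpoly K[n]})^`M(i) = (i == j)%:R.
Proof.
rewrite mderivX mnm1E eq_sym; case: eqP => [->|_]; last by rewrite scale0r.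
by rewrite scale1r -{1}[U_(j)%MM]add0m addmK mpolyX0.
Qed.

(** A derivation that kills the scalars is determined on the image of a
    substitution by its values on the generators. This serves for derivatives
    in an auxiliary parameter and for polarizations alike. *)
Lemma chain_rule (K S : comNzRingType) (n : nat) (f : {rmorphism K -> S})
    (h : 'I_n -> S) (D : {additive S -> S}) (P : {mpoly K[n]}) :
  (forall x y, D (x * y) = D x * y + x * D y) -> (forall c, D (f c) = 0) ->
  D (mmap f h P) = \sum_i mmap f h P^`M(i) * D (h i).
Proof.
move=> DM Df; elim/mpoly_alg_ind: P => [c|j|P Q IHP IHQ|P Q IHP IHQ].
- by rewrite mmapC Df big1 // => i _; rewrite mderivC raddf0 mul0r.
- rewrite mmapX mmap1U (bigD1 j) //= mderivXU eqxx rmorph1 mul1r big1 ?addr0 //.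
  by move=> i /negbTE ij; rewrite mderivXU ij rmorph0 mul0r.
- rewrite !raddfD /= IHP IHQ -big_split; apply: eq_bigr => i _ /=.
  by rewrite raddfD /= mmapD mulrDl.
- rewrite rmorphM DM IHP IHQ mulr_suml mulr_sumr -big_split.
  apply: eq_bigr => i _ /=; rewrite mderivM mmapD !rmorphM /= mulrDl.
  by rewrite mulrA mulrAC.
Qed.

Lemma mderiv_prod (K : comNzRingType) (n : nat) (k : 'I_n) (I : finType)
    (A : {pred I}) (F : I -> {mpoly K[n]}) :
  (\prod_(i in A) F i)^`M(k) =
    \sum_(i in A) (F i)^`M(k) * \prod_(j in A | j != i) F j.
Proof.
have [m leAm] := ubnP #|A|; elim: m => // m IHm in A leAm *.
have [x Ax|A0] := pickP (mem A); last by rewrite !big_pred0 // -mpolyC1 mderivC.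
have {}Ax : x \in A := Ax.
rewrite (bigD1 x) //= mderivM [RHS](bigD1 x) //=; congr (_ + _).
have eqA : [pred i in A | i != x] =i [predD1 A & x].
  by move=> i; rewrite !inE andbC.
rewrite (eq_bigl (mem [predD1 A & x])); last by move=> i; exact: eqA.
rewrite IHm; last by move: leAm; rewrite (cardD1 x) Ax add1n ltnS.
rewrite mulr_sumr; apply: eq_big => [i|i]; first by rewrite -eqA.
rewrite !inE => /andP [xi Ai]; rewrite mulrCA; congr (_ * _).
rewrite [RHS](bigD1 x) ?inE ?Ax 1?eq_sym //=; congr (_ * _).
apply: eq_bigl => j; rewrite !inE.
by rewrite -!andbA; do !bool_congr.
Qed.

(** * Euler operators and the Vandermonde determinant *)

Section Euler.
Variables (K : comNzRingType) (n : nat).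
Implicit Types (P Q : {mpoly K[n]}).

Definition euler (i : 'I_n) P := 'X_i * P^`M(i).

Lemma mcoeff_euler i P m : (euler i P)@_m = P@_m *+ m i.
Proof.
rewrite /euler mulrC; have [Um|] := boolP (U_(i) <= m)%MM.
  rewrite -[in LHS](submK Um) addmC mcoeffMX mcoeff_deriv submK //.
  by rewrite mnmBE mnm1E eqxx subn1 prednK // lt0n -lep1mP.
rewrite lep1mP negbK => mi0; rewrite (eqP mi0) mulr0n mcoeffMr big1 // =>
  -[p q] /= /eqP mE.
rewrite mcoeffX; case: eqP => [qE|_]; last by rewrite mulr0.
by move/mnmP/(_ i)/eqP: mE; rewrite (eqP mi0) mnmDE -qE mnm1E eqxx add1n.
Qed.

Lemma eulerM i P Q : euler i (P * Q) = euler i P * Q + P * euler i Q.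
Proof. by rewrite /euler mderivM; ring. Qed.

Lemma euler_additive i : additive (euler i).
Proof. by move=> P Q; rewrite /euler mderivB mulrBr. Qed.
HB.instance Definition _ i := GRing.isAdditive.Build _ _ (euler i)
  (euler_additive i).

(** The Laplacian of the torus in logarithmic coordinates: it multiplies a
    monomial by the squared length of its exponent. *)
Definition laplace P := \sum_i euler i (euler i P).

Lemma mcoeff_laplace P m : (laplace P)@_m = P@_m * (\sum_i m i ^ 2)%:R.
Proof.
rewrite raddf_sum natr_sum mulr_sumr; apply: eq_bigr => i _ /=.
by rewrite !mcoeff_euler -mulrnA mulr_natr mulnn.
Qed.

Lemma laplaceM P Q :
  laplace (P * Q) = laplace P * Q + 2 * \sum_i euler i P * euler i Q + P *
    laplace Q.
Proof.
rewrite /laplace mulr_suml !mulr_sumr -!big_split; apply: eq_bigr => i _ /=.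
by rewrite eulerM raddfD /= !eulerM; ring.
Qed.

Definition vandermonde : {mpoly K[n]} := \prod_(i < n) \prod_(j < n | (i < j)%N)
  ('X_j - 'X_i).

(** The vector (0, ..., n-1), permuted. Up to sign and a constant vector it is
    the half sum of the positive roots, here with natural numbers as entries
    so that it can be an exponent. *)
Definition rho_perm (p : 'S_n) : 'X_{1..n} :=
  [multinom nat_of_ord (p i) | i < n].

Lemma vandermonde_det : vandermonde = \sum_(p : 'S_n) (-1) ^+ p *:
  'X_[rho_perm p].
Proof.
pose a : 'rV[{mpoly K[n]}]_n := \row_j 'X_j.
transitivity (\det (Vandermonde n a)).
  by rewrite det_Vandermonde; do 2!apply: eq_bigr => ? _; rewrite !mxE.
rewrite -det_tr; apply: eq_bigr => p _; rewrite -mul_mpolyC rmorphXn rmorphN1;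
  congr (_ * _).
rewrite mpolyXE_id; apply: eq_bigr => i _.
by rewrite !mxE !mnmE.
Qed.

(** The exponents of the monomials of the determinant are permutations of one
    vector, hence have the same length. *)
Lemma laplace_vandermonde : laplace vandermonde = (\sum_(i < n) i ^ 2)%:R *
  vandermonde.
Proof.
apply/mpolyP => m; rewrite mcoeff_laplace -mpolyC_nat mul_mpolyC mcoeffZ mulrC.
rewrite vandermonde_det (raddf_sum (mcoeff m)) !mulr_sumr;
  apply: eq_bigr => p _ /=.
rewrite mcoeffZ mcoeffX; case: eqP => [<-|]; last by rewrite !mulr0.
congr (_%:R * _); rewrite [RHS](reindex_inj (@perm_inj _ p)).
by apply: eq_bigr => i _; rewrite !mnmE.
Qed.

(** The quotients of the determinant by X_i - X_j, made antisymmetric in i and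
    j so that sums over ordered pairs can be folded onto unordered ones. *)
Lemma vandermonde_cofactors : exists Q : 'I_n -> 'I_n -> {mpoly K[n]},
  [/\ forall i j, i != j -> ('X_i - 'X_j) * Q i j = vandermonde,
      forall i j, Q j i = - Q i j &
      forall i, vandermonde^`M(i) = \sum_(j | j != i) Q i j].
Proof.
pose A := [pred x : 'I_n * 'I_n | (x.1 < x.2)%N].
pose F (x : 'I_n * 'I_n) : {mpoly K[n]} := 'X_(x.2) - 'X_(x.1).
pose R x := \prod_(y in A | y != x) F y.
have vdmE : vandermonde = \prod_(x in A) F x by rewrite /vandermonde
  pair_big_dep.
pose Q (i j : 'I_n) := if (i < j)%N then - R (i, j) else if (j < i)%N then R (j,
  i) else 0.
exists Q; split=> [i j ij|i j|i].
- rewrite /Q; case: ltngtP => [lij|lji|/val_inj eij];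
  last by rewrite eij eqxx in ij.
    by rewrite mulrN -mulNr opprB vdmE (bigD1 (i, j)).
  by rewrite vdmE (bigD1 (j, i)).
- by rewrite /Q; case: ltngtP => _; rewrite ?opprK ?oppr0.
rewrite vdmE mderiv_prod -(pair_big_dep (fun _ => true) (fun a b : 'I_n =>
  (a < b)%N)
  (fun a b => (F (a, b))^`M(i) * R (a, b))) /=.
under eq_bigr do under eq_bigr do rewrite /F /= mderivB !mderivXU mulrBl.
under eq_bigr do rewrite sumrB.
rewrite sumrB (exchange_big_dep xpredT) //= (bigD1 i) //= [X in _ - X](bigD1 i)
  //=.
rewrite [X in _ + X - _]big1 => [|j /negbTE ji]; last first.
  by rewrite big1 // => l _; rewrite eq_sym ji mul0r.
rewrite [X in _ - (_ + X)]big1 => [|j /negbTE ji]; last first.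
  by rewrite big1 // => l _; rewrite eq_sym ji mul0r.
rewrite !addr0 !(big_mkcond (fun j : 'I_n => (_ < _)%N)) /= (bigD1 i) //=.
rewrite [X in _ - X](bigD1 i) //= ltnn !add0r -sumrB; apply: eq_bigr => j ji.
by rewrite eqxx !mul1r /Q; case: ltngtP => // [_|_|/val_inj eij];
  rewrite ?sub0r ?subr0 ?eij ?eqxx // in ji *.
Qed.

End Euler.

(** * Traces on weight spaces and the Casimir element *)

Lemma eulerX (K : comNzRingType) (n : nat) (i : 'I_n) (m : 'X_{1..n}) :
  euler i 'X_[m] = (m i)%:R *: 'X_[m] :> {mpoly K[n]}.
Proof.
apply/mpolyP => m'; rewrite mcoeff_euler mcoeffZ mcoeffX.
by case: eqP => [->|_]; rewrite ?mul0rn ?mulr0 ?mulr1.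
Qed.

Lemma eulerZ (K : comNzRingType) (n : nat) (i : 'I_n) c (P : {mpoly K[n]}) :
  euler i (c *: P) = c *: euler i P.
Proof. by rewrite /euler mderivZ scalerAr. Qed.

Lemma rank_idempotent (K : fieldType) (r : nat) (Q : 'M[K]_r) :
  Q *m Q = Q -> \tr Q = (\rank Q)%:R.
Proof.
move=> QQ; rewrite -{1}(mulmx_base Q) mxtrace_mulC.
suff -> : row_base Q *m col_base Q = 1%:M by rewrite mxtrace1.
apply: (row_full_inj (col_base_full Q)); apply:
  (row_free_inj (row_base_free Q)).
by rewrite /= mulmx1 mulmxA mulmx_base -mulmxA mulmx_base.
Qed.

(** [E i j] is the action of an elementary matrix of gl_n, from the right on
    row vectors, in a representation with a basis of weight vectors; [wt b] is
    the weight of the basis vector [b]. *)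
Section Casimir.
Variables (K : numClosedFieldType) (n r : nat) (wt : 'I_r -> 'X_{1..n}).
Variables (E : 'I_n -> 'I_n -> 'M[K]_r).
Hypothesis commE : forall i j k l, E i j *m E k l - E k l *m E i j =
  (j == k)%:R *: E i l - (i == l)%:R *: E k j.
Hypothesis diagE : forall i, E i i = diag_mx (\row_b (wt b i)%:R).

(** Comparing commutators with the diagonal matrices [E l l] shows that [E i
    j] lowers the i-th coordinate of a weight and raises the j-th. *)
Lemma weight_shift i j b c : E i j b c != 0 -> (wt b + U_(j) = wt c + U_(i))%MM.
Proof.
move=> e0; apply/mnmP => l; rewrite !mnmDE !mnm1E; apply/eqP.
rewrite -(eqr_nat K) !natrD -(inj_eq (mulIf e0)) !mulrDl.
have /matrixP/(_ b c) := commE l l i j.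
rewrite diagE mul_diag_mx mul_mx_diag !mxE.
rewrite [j == l]eq_sym [i == l]eq_sym.
have -> : (l == i)%:R * E l j b c = (l == i)%:R * E i j b c by case: eqP =>
  [->|_]; rewrite ?mul0r.
have -> : (l == j)%:R * E i l b c = (l == j)%:R * E i j b c by case: eqP =>
  [->|_]; rewrite ?mul0r.
by move/eqP; rewrite subr_eq addrAC eq_sym subr_eq [E i j b c * _]mulrC eq_sym
  [X in _ == X]addrC.
Qed.

(** The generating function of the traces of [Z] on the weight spaces; for [Z
    = 1] it is the character of the representation. *)
Definition weight_trace (Z : 'M[K]_r) : {mpoly K[n]} := \sum_b Z b b *:
  'X_[wt b].

Lemma weight_trace_is_linear : linear weight_trace.
Proof.
move=> a Y Z; rewrite /weight_trace scaler_sumr -big_split;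
  apply: eq_bigr => b _ /=.
by rewrite !mxE scalerDl scalerA.
Qed.
HB.instance Definition _ := GRing.isLinear.Build _ _ _ _ weight_trace
  weight_trace_is_linear.

Lemma weight_trace_diag Z i : weight_trace (Z *m E i i) = euler i (weight_trace
  Z).
Proof.
rewrite /weight_trace raddf_sum; apply: eq_bigr => b _ /=.
by rewrite eulerZ eulerX scalerA diagE mul_mx_diag !mxE.
Qed.

(** The trace of a product is invariant under cyclic permutation; the factors
    X_i and X_j account for the shift of weights by [E i j]. *)
Lemma weight_trace_cyclic Z i j :
  'X_i * weight_trace (Z *m E i j) = 'X_j * weight_trace (E i j *m Z).
Proof.
rewrite /weight_trace !mulr_sumr.
under eq_bigr do rewrite -scalerAr -mpolyXD mxE scaler_suml.
under [RHS]eq_bigr do rewrite -scalerAr -mpolyXD mxE scaler_suml.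
rewrite exchange_big; apply: eq_bigr => b _; apply: eq_bigr => c _ /=.
rewrite [Z c b * _]mulrC; have [->|e0] := eqVneq (E i j b c) 0;
  first by rewrite mul0r !scale0r.
by rewrite addmC -(weight_shift e0) addmC.
Qed.

Variable N : nat.
Hypothesis degE : forall b, mdeg (wt b) = N.

Lemma sum_E : \sum_i E i i = N%:R%:M.
Proof.
apply/matrixP => b c; rewrite summxE mxE.
under eq_bigr do rewrite diagE !mxE.
case: eqP => [->|_]; last by rewrite big1 // => i _; rewrite mulr0n.
by under eq_bigr do rewrite mulr1n; rewrite -natr_sum -mdegE degE mulr1n.
Qed.

Lemma sum_euler_weight_trace Z : \sum_i euler i (weight_trace Z) = N%:R *:
  weight_trace Z.
Proof.
under eq_bigr do rewrite -weight_trace_diag.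
by rewrite -linear_sum -mulmx_sumr sum_E mul_mx_scalar linearZ.
Qed.

Definition casimir : 'M[K]_r := \sum_i \sum_j E j i *m E i j.

Definition central Z := forall i j, comm_mx Z (E i j).

(** Freudenthal's recursion for weight multiplicities, in generating form. Let
    chi be the trace function of [Z], let theta_i be the i-th Euler operator,
    and let G_ij be the trace function of [Z *m E j i *m E i j]. Cyclicity of
    the trace gives (X_i - X_j) G_ij = X_j (theta_i - theta_j) chi, and
    multiplication by the Vandermonde determinant removes the denominators X_i
    - X_j: the contribution of the G_ij becomes the cross term in the
    Laplacian of a product. *)
Lemma laplace_weight_trace Z : central Z ->
  laplace (vandermonde K n * weight_trace Z) =
  (\sum_(i < n) i ^ 2 + n.-1 * N)%:R * (vandermonde K n * weight_trace Z) +
    vandermonde K n * weight_trace (Z *m casimir).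
Proof.
move=> cZ; pose G i j := weight_trace (Z *m E j i *m E i j).
have GE i j : ('X_i - 'X_j) * G i j = 'X_j * (euler i (weight_trace Z) - euler j
  (weight_trace Z)).
  rewrite mulrBl weight_trace_cyclic -mulrBr; congr (_ * _).
  rewrite mulmxA -(cZ i j) /G -!mulmxA -raddfB -mulmxBr commE !eqxx !scale1r.
  by rewrite mulmxBr raddfB /= !weight_trace_diag.
have casE : weight_trace (Z *m casimir) = laplace (weight_trace Z) + \sum_i
  \sum_(j | j != i) G i j.
  rewrite /casimir mulmx_sumr raddf_sum /laplace -big_split;
    apply: eq_bigr => i _ /=.
  rewrite mulmx_sumr raddf_sum (bigD1 i) //= mulmxA !weight_trace_diag;
    congr (_ + _).
  by apply: eq_bigr => j _; rewrite mulmxA.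
have [Q [vdmE QN derE]] := vandermonde_cofactors K n.
pose T i := euler i (weight_trace Z).
have crossE : 2 * \sum_i euler i (vandermonde K n) * T i =
    vandermonde K n * \sum_i \sum_(j | j != i) (T i + G i j).
  pose a i j := 'X_i * Q i j * T i.
  have -> : \sum_i euler i (vandermonde K n) * T i = \sum_i \sum_(j | j != i) a
    i j.
    apply: eq_bigr => i _; rewrite /euler derE mulr_sumr mulr_suml.
    by apply: eq_bigr => j _.
  rewrite mulr_natl mulr2n {2}(exchange_big_dep xpredT) //= -big_split
    mulr_sumr.
  apply: eq_bigr => i _ /=; rewrite [X in _ + X](eq_bigl (fun j => j != i));
    last first.
    by move=> j; rewrite eq_sym.
  rewrite -big_split mulr_sumr; apply: eq_bigr => j ji /=.
  have := GE i j; rewrite -(vdmE i j) 1?eq_sym // /a (QN i j) -/(T i) -/(T j) =>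
    GEij.
  transitivity (('X_i - 'X_j) * Q i j * T i + Q i j * ('X_j * (T i - T j)));
    first by ring.
  by rewrite -GEij; ring.
have sumTG : \sum_i \sum_(j | j != i) (T i + G i j) =
    (n.-1 * N)%:R * weight_trace Z + \sum_i \sum_(j | j != i) G i j.
  under eq_bigr do rewrite big_split sumr_const /=.
  rewrite big_split /=; congr (_ + _).
  under eq_bigr => i _ do rewrite (cardC1 i) card_ord.
  by rewrite sumrMnl sum_euler_weight_trace natrM -mulrA [N%:R * _]mulr_natl
    scaler_nat mulr_natl.
by rewrite laplaceM crossE sumTG laplace_vandermonde casE natrD; ring.
Qed.

Variable m : nat.
Hypothesis NE : N = (n * m)%N.

(** The weight of the m-th power of the determinant, shifted by rho. *)
Definition rho_shift : 'X_{1..n} := [multinom (i + m)%N | i < n].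

(** By the expansion of the Vandermonde determinant this is the alternating
    sum, over the permutations p, of the traces of [Z] on the weight spaces of
    rho + (m, ..., m) - p rho. *)
Definition alternating_trace Z := (vandermonde K n * weight_trace
  Z)@_(rho_shift).

Lemma alternating_traceE Z : alternating_trace Z = \sum_(p : 'S_n) (-1) ^+ p *
   \sum_(b | (wt b + rho_perm p)%MM == rho_shift) Z b b.
Proof.
rewrite /alternating_trace vandermonde_det mulr_suml raddf_sum;
  apply: eq_bigr => p _ /=.
rewrite -scalerAl mcoeffZ; congr (_ * _);
  rewrite /weight_trace mulr_sumr raddf_sum /=.
rewrite [RHS]big_mkcond; apply: eq_bigr => b _ /=.
rewrite -scalerAr mcoeffZ -mpolyXD mcoeffX addmC.
by case: eqP; rewrite ?mulr1 ?mulr0.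
Qed.

(** The number n m^2 is the value of the Casimir on the m-th power of the
    determinant. *)
Definition shifted_casimir := casimir - (n * m ^ 2)%:R%:M.

(** Compare the coefficients at rho + (m, ..., m) in [laplace_weight_trace]:
    the squared length of this exponent exceeds that of rho by n m^2 + (n - 1)
    n m. *)
Lemma alternating_trace_casimir Z : central Z ->
  alternating_trace (Z *m shifted_casimir) = 0.
Proof.
move=> cZ; rewrite /alternating_trace mulmxBr raddfB mulrBr raddfB /=
  mul_mx_scalar linearZ /=.
rewrite -scalerAr mcoeffZ; apply/eqP; rewrite subr_eq0; apply/eqP.
have /(congr1 (mcoeff rho_shift)) := laplace_weight_trace cZ.
rewrite mcoeffD mcoeff_laplace -mpolyC_nat mul_mpolyC mcoeffZ mulrC.
move/eqP; rewrite addrC -subr_eq -mulrBl => /eqP <-; congr (_ * _).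
suff -> : (\sum_i rho_shift i ^ 2 = n * m ^ 2 + (\sum_(i < n) i ^ 2 + n.-1 *
  N))%N.
  by rewrite natrD addrK.
under eq_bigr do rewrite mnmE sqrnD.
rewrite 2!big_split /= sum_nat_const card_ord NE [X in (X + _)%N]addnC -addnA.
congr (_ + (_ + _))%N; rewrite -big_distrr -big_distrl /= mulnA.
rewrite -(big_mkord xpredT id) bin2_sum -mul_bin_diag bin1.
by rewrite mulnCA mulnA.
Qed.

Lemma central_casimir : central shifted_casimir.
Proof.
move=> k l; rewrite /comm_mx mulmxBl mulmxBr scalar_mxC; congr (_ - _).
apply/eqP; rewrite -subr_eq0 mulmx_suml mulmx_sumr -sumrB.
have step i j : E j i *m E i j *m E k l - E k l *m (E j i *m E i j) =
    E j i *m ((j == k)%:R *: E i l - (i == l)%:R *: E k j) +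
    ((i == k)%:R *: E j l - (j == l)%:R *: E k i) *m E i j.
  by rewrite -!commE mulmxBr mulmxBl !mulmxA addrA subrK.
under eq_bigr => i _ do rewrite mulmx_suml mulmx_sumr -sumrB (eq_bigr _ (fun j _
  => step i j)).
have delta (f : 'I_n -> 'M[K]_r) c : \sum_i (i == c)%:R *: f i = f c.
  rewrite (bigD1 c) //= eqxx scale1r big1 ?addr0 // => i /negbTE ->.
  by rewrite scale0r.
(* The commutators with the factors E i j contribute A - B, those with the
   factors E j i contribute B - A. *)
pose A := \sum_i E k i *m E i l; pose B := \sum_i E i l *m E k i.
have -> : \sum_i \sum_j (E j i *m ((j == k)%:R *: E i l - (i == l)%:R *:
  E k j) +
    ((i == k)%:R *: E j l - (j == l)%:R *: E k i) *m E i j) = A - B + (B - A).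
  under eq_bigr do rewrite big_split /=.
  rewrite big_split /=; congr (_ + _).
    under eq_bigr do under eq_bigr do rewrite mulmxBr -!scalemxAr.
    under eq_bigr do rewrite sumrB delta -scaler_sumr.
    by rewrite sumrB delta.
  under eq_bigr do under eq_bigr do rewrite mulmxBl -!scalemxAl.
  under eq_bigr do rewrite sumrB delta -scaler_sumr.
  by rewrite sumrB delta.
by rewrite addrA subrK subrr.
Qed.

(** The representation twisted by the power -m of the determinant, so that its
    invariants are the vectors on which gl_n acts through det^m. *)
Definition twist i j : 'M[K]_r := E i j - (m * (i == j))%:R%:M.

(** The shifted Casimir is the Casimir of the twisted representation. *)
Lemma shifted_casimirE :
  shifted_casimir = \sum_i \sum_j twist j i *m twist i j.
Proof.
have delta (f : 'I_n -> 'M[K]_r) i : \sum_j (m * (i == j))%:R *: f j = m%:R *: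
  f i.
  rewrite (bigD1 i) //= eqxx muln1 big1 ?addr0 // => j /negbTE.
  by rewrite eq_sym => ->; rewrite muln0 scale0r.
have term i : \sum_j twist j i *m twist i j =
    \sum_j E j i *m E i j - (2 * m)%:R *: E i i + (m ^ 2)%:R%:M.
  have scalar_mx0 : 0%:M = 0 :> 'M[K]_r by rewrite -scalemx1 scale0r.
  have step j : twist j i *m twist i j = E j i *m E i j +
      (m * (i == j))%:R *: (m%:R%:M - 2 *: E i i).
    rewrite /twist eq_sym; case: eqP => [<-|_]; last first.
      by rewrite muln0 scale0r addr0 mulr0n scalar_mx0 !subr0.
    rewrite muln1 mulmxBl !mulmxBr mul_scalar_mx mul_mx_scalar mul_scalar_mx.
    rewrite scalerBr scalerA -addrA; congr (_ + _).
    by rewrite opprB addrCA -opprD [m%:R * 2]mulrC -scalerA [2 *: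
      _]scaler_nat mulr2n.
  rewrite (eq_bigr _ (fun j _ => step j)) big_split /= delta scalerBr -addrA;
    congr (_ + _).
  by rewrite scale_scalar_mx -natrM mulnn scalerA -natrM mulnC addrC.
under eq_bigr do rewrite term.
rewrite !big_split /= sumrN -scaler_sumr sum_E sumr_const card_ord NE.
rewrite /shifted_casimir -addrA; congr (_ + _).
rewrite scale_scalar_mx -scaler_nat scale_scalar_mx -!rmorphN -rmorphD /=.
by congr (_%:M); rewrite -!natrM; ring.
Qed.

(** A Hermitian form for which the basis is orthogonal, with squared norms
    [gam b], and [E i j] is adjoint to [E j i]. *)
Variable gam : 'I_r -> K.
Hypothesis gam_gt0 : forall b, 0 < gam b.
Hypothesis adjE : forall i j b c, E i j b c * gam c = gam b * (E j i c b)^*.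

Definition herm (u w : 'rV[K]_r) := \sum_b u 0 b * (w 0 b)^* * gam b.

Lemma herm_ge0 u : 0 <= herm u u.
Proof.
by apply: sumr_ge0 => b _; rewrite mulr_ge0 ?mul_conjC_ge0 // ltW.
Qed.

Lemma herm_eq0 u : herm u u = 0 -> u = 0.
Proof.
move/eqP; rewrite psumr_eq0 => [/allP h|b _];
  last by rewrite mulr_ge0 ?mul_conjC_ge0 // ltW.
apply/rowP => b; rewrite mxE; apply/eqP; move: (h b).
by rewrite mem_index_enum mulf_eq0 mul_conjC_eq0 (gt_eqF (gam_gt0 b)) orbF =>
  /(_ isT).
Qed.

Lemma herm_twist i j u w : herm (u *m twist i j) w = herm u (w *m twist j i).
Proof.
have adj b c : twist i j b c * gam c = gam b * (twist j i c b)^*.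
  rewrite !mxE mulrBl adjE rmorphB mulrBr; congr (_ - _).
  rewrite -!mulrnA rmorph_nat [b == c]eq_sym [i == j]eq_sym.
  by case: (c =P b) => [->|_]; rewrite ?muln0 ?mul0r ?mulr0 // mulrC.
rewrite /herm; under eq_bigr do rewrite mxE !mulr_suml.
rewrite exchange_big; apply: eq_bigr => b _ /=.
rewrite mxE rmorph_sum mulr_sumr mulr_suml; apply: eq_bigr => c _.
rewrite rmorphM; have := adj b c; set x := twist _ _ _ _;
  set y := twist _ _ _ _ => xy.
transitivity (u 0 b * (w 0 c)^* * (x * gam c)); first by ring.
by rewrite xy /=; ring.
Qed.

Lemma herm_casimir u w : herm (u *m shifted_casimir) w = herm u (w *m
  shifted_casimir) /\
  herm (u *m shifted_casimir) w = \sum_i \sum_j herm (u *m twist j i) (w *m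
    twist j i).
Proof.
have hl (I : finType) (f : I -> 'rV_r) z : herm (\sum_i f i) z = \sum_i herm (f
  i) z.
  rewrite /herm exchange_big; apply: eq_bigr => b _.
  by rewrite summxE !mulr_suml.
have hr (I : finType) (f : I -> 'rV_r) z : herm z (\sum_i f i) = \sum_i herm z
  (f i).
  rewrite /herm exchange_big; apply: eq_bigr => b _.
  by rewrite summxE rmorph_sum mulr_sumr mulr_suml.
have e : herm (u *m shifted_casimir) w = \sum_i \sum_j herm (u *m twist j i) (w
  *m twist j i).
  rewrite shifted_casimirE mulmx_sumr hl; apply: eq_bigr => i _.
  by rewrite mulmx_sumr hl; apply: eq_bigr => j _; rewrite mulmxA herm_twist.
split=> //; rewrite e shifted_casimirE mulmx_sumr hr; apply: eq_bigr => i _.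
by rewrite mulmx_sumr hr; apply: eq_bigr => j _; rewrite mulmxA herm_twist.
Qed.

(** For the shifted Casimir S and the twisted representation F, the Hermitian
    product of v S and v is the sum of the squared norms of the vectors
    v F_ij. *)
Lemma casimir_ker (v : 'rV[K]_r) : v *m shifted_casimir = 0 <-> forall i j,
  v *m twist i j = 0.
Proof.
split=> [v0 i j|v0]; last first.
  by rewrite shifted_casimirE mulmx_sumr big1 // => i _;
    rewrite mulmx_sumr big1 // => j _; rewrite mulmxA v0 mul0mx.
have [_] := herm_casimir v v; rewrite v0 {1}/herm big1 => [|b _];
  last by rewrite mxE !mul0r.
move/esym/eqP; rewrite psumr_eq0 => [/allP/(_ j)|k _];
  last by apply: sumr_ge0 => l _; apply: herm_ge0.
rewrite mem_index_enum psumr_eq0 => [/(_ isT)/allP/(_ i)|k _];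
  last exact: herm_ge0.
by rewrite mem_index_enum => /(_ isT)/eqP/herm_eq0.
Qed.

(** Self-adjointness makes the shifted Casimir semisimple. *)
Lemma casimir_ker2 (v : 'rV[K]_r) : v *m shifted_casimir *m shifted_casimir = 0
  -> v *m shifted_casimir = 0.
Proof.
move=> v0; apply: herm_eq0; have [<- _] := herm_casimir (v *m shifted_casimir)
  v.
by rewrite v0 /herm big1 // => b _; rewrite mxE !mul0r.
Qed.

Lemma twist_weight (v : 'rV[K]_r) b : (forall i j, v *m twist i j = 0) ->
  v 0 b != 0 -> wt b = [multinom m | _ < n] :> 'X_{1..n}.
Proof.
move=> v0 vb; apply/mnmP => i; rewrite mnmE; apply/eqP; rewrite -(eqr_nat K).
move/rowP/(_ b)/eqP: (v0 i i); rewrite /twist mulmxBr mul_mx_scalar eqxx muln1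
  diagE mul_mx_diag.
by rewrite !mxE mulrC -mulrBl mulf_eq0 (negbTE vb) orbF subr_eq0.
Qed.

End Casimir.

(** The characteristic polynomial is X^e g with g(0) nonzero. By hypothesis e
    can be lowered to 1, and then g / g(0) has the required properties. *)
Lemma semisimple_projector (K : fieldType) (r : nat) (S : 'M[K]_r.+1) :
  (forall v : 'rV_r.+1, v *m S *m S = 0 -> v *m S = 0) ->
  exists q, q.[0] = 1 /\ horner_mx S q *m S = 0.
Proof.
move=> S2.
have {}S2 (X : 'M[K]_r.+1) : X *m S *m S = 0 -> X *m S = 0.
  move=> XS; apply/row_matrixP => i; rewrite row_mul row0; apply: S2.
  by rewrite -!row_mul XS row0.
have p0 : char_poly S != 0 by rewrite monic_neq0 ?char_poly_monic.
have [e [g g0 pE]] := multiplicity_XsubC (char_poly S) 0.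
rewrite p0 /= in g0; rewrite subr0 in pE.
have : horner_mx S g *m S ^+ e = 0.
  by rewrite -{2}[S]horner_mx_X -rmorphXn /= -[_ *m _]rmorphM -pE /=
    Cayley_Hamilton.
have Se : horner_mx S g *m S ^+ e.+1 = 0 -> horner_mx S g *m S = 0.
  elim: e {pE} => // e IH; rewrite 2!exprSr !mulmxA => /S2 h; apply: IH.
  by rewrite exprSr mulmxA.
move=> h; exists (g.[0]^-1 *: g); split; first by rewrite hornerZ mulVf.
by rewrite linearZ /= -scalemxAl Se ?scaler0 // exprSr [LHS]mulmxA h mul0mx.
Qed.

(** The functional [alternating_trace] vanishes on central multiples of the
    shifted Casimir S, so it takes the same value at 1 and at a projector onto
    ker S that is a polynomial in S with value 1 at 0. At 1 the value is the
    alternating sum of weight multiplicities. At the projector only the weight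
    (m, ..., m) contributes, and the value is the trace, which is the rank. *)
Lemma invariant_rank (K : numClosedFieldType) (n r m : nat) (wt : 'I_r ->
  'X_{1..n})
    (E : 'I_n -> 'I_n -> 'M[K]_r) (gam : 'I_r -> K) :
  (forall i j k l, E i j *m E k l - E k l *m E i j =
     (j == k)%:R *: E i l - (i == l)%:R *: E k j) ->
  (forall i, E i i = diag_mx (\row_b (wt b i)%:R)) ->
  (forall b, mdeg (wt b) = (n * m)%N) ->
  (forall b, 0 < gam b) ->
  (forall i j b c, E i j b c * gam c = gam b * (E j i c b)^*) ->
  exists M : 'M[K]_r,
    (forall v : 'rV_r, (v <= M)%MS <-> forall i j, v *m twist E m i j = 0) /\
    (\rank M)%:R = \sum_(p : 'S_n) (-1) ^+ p *
       #|[set b | (wt b + rho_perm p)%MM == rho_shift n m]|%:R :> K.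
Proof.
case: r => [|r] in wt E gam *.
  (* Polynomials in a matrix are only defined for nonempty matrices. *)
  move=> _ _ _ _ _; exists 0; split=> [v|].
    by split=> _; [move=> i j; rewrite [_ *m _]thinmx0 | rewrite [v]thinmx0
      sub0mx].
  rewrite mxrank0 big1 // => p _; rewrite [X in X%:R](_ : _ = 0%N) ?mulr0 //.
  by apply: eq_card0 => -[].
move=> commE diagE degE gam0 adjE; set S := shifted_casimir E m.
have [q [q0 qS]] := semisimple_projector (casimir_ker2 diagE degE erefl gam0
  adjE).
set Q := horner_mx S q.
have cS p : central E (horner_mx S p).
  by move=> i j; apply: comm_horner_mx; apply: central_casimir.
have actS (v : 'rV_r.+1) p : v *m S = 0 -> v *m horner_mx S p = p.[0] *: v.
  move=> vS; have [p1 ->] : exists p1, p = 'X * p1 + p.[0]%:P.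
    exists ((p - p.[0]%:P) %/ 'X); rewrite mulrC divpK ?subrK //.
    by rewrite -['X]subr0 dvdp_XsubCl /root !hornerE subrr.
  rewrite rmorphD rmorphM /= horner_mx_C horner_mx_X mulmxDr [_ *m (_ *
    _)]mulmxA vS mul0mx add0r.
  by rewrite mul_mx_scalar !hornerE.
have QP (v : 'rV_r.+1) : (v <= Q)%MS <-> forall i j, v *m twist E m i j = 0.
  rewrite -(casimir_ker diagE degE erefl gam0 adjE);
    split=> [/submxP [w ->]|vS].
    by rewrite -mulmxA qS mulmx0.
  by apply/submxP; exists v; rewrite actS // q0 scale1r.
exists Q; split=> //.
have QQ : Q *m Q = Q.
  apply/row_matrixP => i; rewrite row_mul actS ?q0 ?scale1r //.
  by rewrite -row_mul qS row0.
rewrite -rank_idempotent //.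
have AQ : alternating_trace wt m Q = alternating_trace wt m 1%:M.
  have [p1 qE] : exists p1, q = p1 * 'X + 1%:P.
    exists ((q - 1%:P) %/ 'X); rewrite divpK ?subrK //.
    by rewrite -['X]subr0 dvdp_XsubCl /root !hornerE q0 subrr.
  rewrite /Q qE rmorphD rmorphM /= horner_mx_C horner_mx_X.
  rewrite /alternating_trace raddfD mulrDr mcoeffD.
  by rewrite [X in X + _](alternating_trace_casimir commE diagE degE erefl (cS
    p1)) add0r.
have wtQ b c : Q b c != 0 -> wt c = [multinom m | _ < n] :> 'X_{1..n}.
  move=> Qbc; apply: (@twist_weight _ _ _ _ _ diagE m (row b Q));
    last by rewrite mxE.
  by apply/QP; apply: row_sub.
transitivity (alternating_trace wt m Q); last first.
  rewrite AQ alternating_traceE; apply: eq_bigr => p _; congr (_ * _).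
  rewrite -sum1_card natr_sum; apply: eq_big => [b|b _]; first by rewrite inE.
  by rewrite mxE eqxx.
rewrite alternating_traceE (bigD1 1%g) //= odd_perm1 expr0 mul1r [X in _ +
  X]big1 ?addr0 => [|p p1].
  rewrite [RHS]big_mkcond; apply: eq_bigr => b _.
  case: eqP => // neq; apply/eqP/negPn/negP => /wtQ wtb; case: neq.
  by apply/mnmP => i; rewrite mnmDE wtb !mnmE perm1 addnC.
rewrite big1 ?mulr0 // => b /eqP/mnmP bE; apply/eqP/negPn/negP => /wtQ wtb.
case/eqP: p1; apply/permP => i; rewrite perm1; apply/val_inj/eqP.
by move/eqP: (bE i); rewrite mnmDE wtb !mnmE addnC eqn_add2r.
Qed.

(** * Polarizations of forms and of their coefficients *)

Section Polar.
Variables (K : comNzRingType) (n : nat).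
Implicit Types F : {mpoly K[n]}.

(** The polarization operators of classical invariant theory, through which
    the elementary matrices of gl_n act on polynomials. *)
Definition polar (i j : 'I_n) F := 'X_j * F^`M(i).

Lemma polar_is_linear i j : linear (polar i j).
Proof. by move=> c F G; rewrite /polar mderivD mderivZ mulrDr scalerAr. Qed.
HB.instance Definition _ i j := GRing.isLinear.Build _ _ _ _ (polar i j)
  (polar_is_linear i j).

Lemma polarX i j m : polar i j 'X_[m] = (m i)%:R *: 'X_[m - U_(i) + U_(j)].
Proof. by rewrite /polar mderivX -scalerAr -mpolyXD addmC. Qed.

Lemma mcoeff_polarX i j m m' :
  (polar i j 'X_[m])@_m' = (m i * (m + U_(j) == m' + U_(i))%MM)%:R.
Proof.
rewrite polarX mcoeffZ mcoeffX natrM.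
have [->|mi] := eqVneq (m i) 0%N; first by rewrite !mul0r.
by rewrite -(eqm_add2r U_(i)) -addmA [(U_(j) + _)%MM]addmC addmA submK ?lep1mP.
Qed.

Lemma polar_comm i j k l F : polar i j (polar k l F) - polar k l (polar i j F) =
  (i == l)%:R *: polar k j F - (k == j)%:R *: polar i l F.
Proof.
rewrite /polar !mderivM !mderivXU mderiv_comm -!mul_mpolyC !mpolyC_nat.
by ring.
Qed.

Definition mfact (m : 'X_{1..n}) := (\prod_i (m i)`!)%N.

Lemma mfact_gt0 m : (0 < mfact m)%N.
Proof. by apply: prodn_gt0 => i; rewrite fact_gt0. Qed.

Lemma mfactD m i : mfact (m + U_(i)) = (mfact m * (m i).+1)%N.
Proof.
rewrite /mfact (bigD1 i) //= [in RHS](bigD1 i) //= mnmDE mnm1E eqxx addn1 factS.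
rewrite -mulnA [RHS]mulnC; congr (_ * (_ * _))%N.
by apply: eq_bigr => j /negbTE ji; rewrite mnmDE mnm1E eq_sym ji addn0.
Qed.

(** The operators x_j d/dx_i and x_i d/dx_j are adjoint for the Fischer form,
    in which monomials are orthogonal and x^m has squared norm m!. *)
Lemma polar_adj i j m m' : (polar i j 'X_[m])@_m' * (mfact m')%:R =
  (polar j i 'X_[m'])@_m * (mfact m)%:R.
Proof.
rewrite !mcoeff_polarX [(m' + _ == _)%MM]eq_sym -!natrM; congr _%:R.
case: eqP => [mm'|_]; last by rewrite !muln0.
rewrite !muln1.
have [ij|ij] := eqVneq i j.
  by move: mm'; rewrite ij => /addIm ->.
have := congr1 mfact mm'; rewrite !mfactD.
have /mnmP mm'E := mm'; have := mm'E i; have := mm'E j.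
rewrite !mnmDE !mnm1E !eqxx [j == i]eq_sym (negbTE ij) !addn0 !addn1 => -> <-.
by move=> h; rewrite mulnC -h mulnC.
Qed.

End Polar.

Section Umbra.
Variables (K : comNzRingType) (n d N : nat) (M : 'I_N -> 'X_{1..n}).
Hypothesis M_inj : injective M.
Hypothesis M_deg : forall u, mdeg (M u) = d.
Hypothesis M_onto : forall m, mdeg m = d -> exists u, M u = m.

(** The symbolic method: the monomial with exponent [M u] stands for the
    variable [u], a coefficient of the general form. Linear forms in the
    coefficients are thus represented by forms in the x_i. *)
Definition umbra (F : {mpoly K[n]}) : {mpoly K[N]} := \sum_u F@_(M u) *: 'X_u.

Lemma umbra_is_linear : linear umbra.
Proof.
move=> c F G; rewrite /umbra scaler_sumr -big_split; apply: eq_bigr => u _ /=.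
by rewrite mcoeffD mcoeffZ scalerDl scalerA.
Qed.
HB.instance Definition _ := GRing.isLinear.Build _ _ _ _ umbra umbra_is_linear.

Lemma umbraX u : umbra 'X_[M u] = 'X_u.
Proof.
rewrite /umbra (bigD1 u) //= mcoeffX eqxx scale1r big1 ?addr0 // => v vu.
by rewrite mcoeffX (inj_eq M_inj) eq_sym (negbTE vu) scale0r.
Qed.

Lemma umbraX0 m : mdeg m != d -> umbra 'X_[m] = 0.
Proof.
move=> md; rewrite /umbra big1 // => v _.
rewrite mcoeffX; case: eqP => [mE|]; last by rewrite scale0r.
by rewrite mE M_deg eqxx in md.
Qed.

(** The derivation of the algebra of coefficients that acts on symbols as a
    polarization. *)
Definition ind_polar i j (P : {mpoly K[N]}) : {mpoly K[N]} :=
  \sum_u umbra (polar i j 'X_[M u]) * P^`M(u).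

Lemma ind_polar_is_linear i j : linear (ind_polar i j).
Proof.
move=> c F G; rewrite /ind_polar scaler_sumr -big_split;
  apply: eq_bigr => u _ /=.
by rewrite mderivD mderivZ mulrDr scalerAr.
Qed.
HB.instance Definition _ i j := GRing.isLinear.Build _ _ _ _ (ind_polar i j)
  (ind_polar_is_linear i j).

Lemma ind_polarM i j P Q : ind_polar i j (P * Q) = ind_polar i j P * Q + P *
  ind_polar i j Q.
Proof.
rewrite /ind_polar mulr_suml mulr_sumr -big_split; apply: eq_bigr => u _ /=.
by rewrite mderivM; ring.
Qed.

Lemma ind_polarC i j c : ind_polar i j c%:MP = 0.
Proof. by rewrite /ind_polar big1 // => u _; rewrite mderivC mulr0. Qed.

Lemma ind_polarXU i j u : ind_polar i j 'X_u = umbra (polar i j 'X_[M u]).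
Proof.
rewrite /ind_polar (bigD1 u) //= mderivXU eqxx mulr1 big1 ?addr0 // => v vu.
by rewrite mderivXU (negbTE vu) mulr0.
Qed.

Lemma ind_polar_umbra i j F : ind_polar i j (umbra F) = umbra (polar i j F).
Proof.
elim/mpolyind: F => [|c m F _ _ IH]; first by rewrite !linear0.
rewrite !linearP /= IH; congr (_ *: _ + _) => {IH}.
have [md|md] := eqVneq (mdeg m) d.
  by have [u <-] := M_onto md; rewrite umbraX ind_polarXU.
rewrite umbraX0 // linear0 polarX linearZ /=.
have [->|mi] := eqVneq (m i) 0%N; first by rewrite scale0r.
rewrite umbraX0 ?scaler0 //.
by rewrite mdegD mdeg1 -(mdeg1 i) -mdegD submK ?lep1mP.
Qed.

(** Both sides are derivations, so linear forms suffice; on symbols the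
    relation is that of the Weyl algebra. *)
Lemma ind_polar_comm i j k l P : ind_polar i j (ind_polar k l P) - ind_polar k l
  (ind_polar i j P) =
  (i == l)%:R *: ind_polar k j P - (k == j)%:R *: ind_polar i l P.
Proof.
elim/mpoly_alg_ind: P => [c|u|P Q IHP IHQ|P Q IHP IHQ].
- by rewrite !ind_polarC !linear0 ?scaler0 ?subr0.
- by rewrite -umbraX !ind_polar_umbra -linearB /= polar_comm linearB !linearZ.
- by rewrite !linearD /= addrACA IHP IHQ [RHS]addrACA.
rewrite !ind_polarM !linearD /= !ind_polarM -!mul_mpolyC.
move: IHP IHQ; rewrite -!mul_mpolyC.
move: (ind_polar i j (ind_polar k l P)) (ind_polar k l (ind_polar i j P))
  (ind_polar i j (ind_polar k l Q))
  (ind_polar k l (ind_polar i j Q)) => P1 P2 Q1 Q2 /(canRL (subrK _)) ->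
    /(canRL (subrK _)) ->.
move: (ind_polar k j P) (ind_polar i l P) (ind_polar k j Q) (ind_polar i l Q)
  (ind_polar i j P) (ind_polar k l P)
  (ind_polar i j Q) (ind_polar k l Q) => *; ring.
Qed.

Definition weight_of (b : 'X_{1..N}) : 'X_{1..n} := (\sum_u M u *+ b u)%MM.

Lemma mdeg_weight_of b : mdeg (weight_of b) = (d * mdeg b)%N.
Proof.
rewrite mdeg_sum mdegE big_distrr; apply: eq_bigr => u _ /=.
by rewrite mdegMn M_deg.
Qed.

Lemma ind_polar_diagX i b : ind_polar i i 'X_[b] = (weight_of b i)%:R *: 'X_[b].
Proof.
rewrite /weight_of mnm_sumE natr_sum scaler_suml; apply: eq_bigr => u _.
rewrite -[polar _ _ _]/(euler _ _) eulerX linearZ /= umbraX -scalerAl.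
by rewrite -[_ * _]/(euler u _) eulerX scalerA mulmnE natrM.
Qed.

Lemma ind_polarE i j P : ind_polar i j P =
  \sum_u \sum_v (polar i j 'X_[M u])@_(M v) *: polar u v P.
Proof.
apply: eq_bigr => u _; rewrite mulr_suml; apply: eq_bigr => v _.
by rewrite -scalerAl.
Qed.

Lemma ind_polar_homog k i j P : P \is k.-homog -> ind_polar i j P \is k.-homog.
Proof.
move=> Pk; rewrite ind_polarE; apply: rpred_sum => u _; apply: rpred_sum => v _.
apply: rpredZ; rewrite (mpolyE P) linear_sum big_seq; apply: rpred_sum => b bP.
rewrite linearZ /=; apply: rpredZ; rewrite polarX.
have [->|bu] := eqVneq (b u) 0%N; first by rewrite scale0r rpred0.
apply: rpredZ; rewrite dhomogX /= mdegD mdeg1 -(mdeg1 u) -mdegD submK ?lep1mP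
  //.
exact/eqP/(dhomog_mf Pk).
Qed.

(** Moves a polarization from a form to the symbols of its coefficients. *)
Lemma polar_adj_sum i j (G : {mpoly K[n]}) u :
  (polar i j G)@_(M u) * (mfact (M u))%:R =
  \sum_v (polar j i ('X_[M u] : {mpoly K[n]}))@_(M v) * (G@_(M v) * (mfact (M
    v))%:R).
Proof.
elim/mpolyind: G => [|c m G _ _ IH].
  by rewrite linear0 mcoeff0 mul0r big1 // => v _; rewrite mcoeff0 mul0r mulr0.
rewrite linearP /= mcoeffD mcoeffZ mulrDl IH -mulrA polar_adj.
under [RHS]eq_bigr do rewrite mcoeffD mulrDl mulrDr.
rewrite big_split /=; congr (_ + _).
have [md|md] := eqVneq (mdeg m) d.
  have [v <-] := M_onto md; rewrite (bigD1 v) //= mcoeffZ mcoeffX eqxx mulr1.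
  rewrite big1 ?addr0; first by rewrite mulrCA.
  by move=> w wv; rewrite mcoeffZ mcoeffX (inj_eq M_inj) eq_sym (negbTE wv)
    mulr0 mul0r mulr0.
rewrite mcoeff_polarX; case: (_ =P _) => [mE|_]; last first.
  rewrite muln0 mul0r mulr0 big1 // => v _; rewrite mcoeffZ mcoeffX.
  by case: eqP => [mv|]; rewrite ?(mulr0, mul0r) //;
    rewrite mv M_deg eqxx in md.
by move/(congr1 (@mdeg n)): mE; rewrite !mdegD !mdeg1 M_deg => /addIn mE;
  rewrite -mE eqxx in md.
Qed.

End Umbra.

Section Matrix.
Variables (K : numClosedFieldType) (n d N k r : nat) (M : 'I_N -> 'X_{1..n}).
Hypothesis M_inj : injective M.
Hypothesis M_deg : forall u, mdeg (M u) = d.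
Hypothesis M_onto : forall m, mdeg m = d -> exists u, M u = m.
Variable e : 'I_r -> 'X_{1..N}.
Hypothesis e_inj : injective e.
Hypothesis e_deg : forall b, mdeg (e b) = k.
Hypothesis e_onto : forall m, mdeg m = k -> exists b, e b = m.
Notation ind_polar := (@ind_polar K n N M).

Definition coords (P : {mpoly K[N]}) : 'rV[K]_r := \row_b P@_(e b).

Lemma coords_is_linear : linear coords.
Proof. by move=> c P Q; apply/rowP => b; rewrite !mxE mcoeffD mcoeffZ. Qed.
HB.instance Definition _ := GRing.isLinear.Build _ _ _ _ coords
  coords_is_linear.

(** These matrices act on row vectors from the right, so that their products
    are in the reverse order of composition. *)
Definition polar_mx i j : 'M[K]_r :=
  \matrix_(b, c) (ind_polar i j 'X_[e b])@_(e c).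

Lemma homog_coords (P : {mpoly K[N]}) : P \is k.-homog -> P = \sum_b P@_(e b) *:
  'X_[e b].
Proof.
move=> Pk; apply/mpolyP => m; rewrite raddf_sum /=.
have [md|md] := eqVneq (mdeg m) k; last first.
  rewrite (dhomog_nemf_coeff Pk md) big1 // => b _; rewrite mcoeffZ mcoeffX.
  by case: eqP => [bm|_]; rewrite ?mulr0 // -bm e_deg eqxx in md *.
have [b <-] := e_onto md; rewrite (bigD1 b) //= mcoeffZ mcoeffX eqxx mulr1.
rewrite big1 ?addr0 // => c cb; rewrite mcoeffZ mcoeffX (inj_eq e_inj) (negbTE
  cb).
by rewrite mulr0.
Qed.

Lemma coords_inj (P Q : {mpoly K[N]}) : P \is k.-homog -> Q \is k.-homog ->
  coords P = coords Q -> P = Q.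
Proof.
move=> Pk Qk /rowP PQ; rewrite (homog_coords Pk) (homog_coords Qk).
by apply: eq_bigr => b _; move: (PQ b); rewrite !mxE => ->.
Qed.

Lemma coords_ind_polar i j (P : {mpoly K[N]}) : P \is k.-homog ->
  coords (ind_polar i j P) = coords P *m polar_mx i j.
Proof.
move=> Pk; rewrite {1}(homog_coords Pk) (linear_sum (ind_polar i j)) (linear_sum
  coords) /=.
apply/rowP => c; rewrite summxE !mxE; apply: eq_bigr => b _.
by rewrite linearZ /= !mxE mcoeffZ.
Qed.

Lemma homog_e b : ('X_[e b] : {mpoly K[N]}) \is k.-homog.
Proof. by rewrite dhomogX /= e_deg. Qed.

Lemma row_polar_mx i j b : row b (polar_mx i j) = coords (ind_polar i j 'X_[e
  b]).
Proof. by apply/rowP => c; rewrite !mxE. Qed.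

Lemma polar_mx_comm i j p q : polar_mx i j *m polar_mx p q - polar_mx p q *m
  polar_mx i j =
  (j == p)%:R *: polar_mx i q - (i == q)%:R *: polar_mx p j.
Proof.
apply/matrixP => b c.
have rowE i' j' p' q' : (polar_mx i' j' *m polar_mx p' q') b c = (ind_polar p'
  q' (ind_polar i' j' 'X_[e b]))@_(e c).
  have /rowP/(_ c) := coords_ind_polar p' q' (ind_polar_homog M i' j' (homog_e
    b)).
  by rewrite -row_polar_mx -row_mul !mxE.
have subE (A B : 'M[K]_r) : (A - B) b c = A b c - B b c by rewrite !mxE.
have scaleE a i' j' : (a *: polar_mx i' j') b c = a * (ind_polar i' j' 'X_[e
  b])@_(e c).
  by rewrite !mxE.
have coefE (P1 P2 Q1 Q2 : {mpoly K[N]}) (a1 a2 : K) m : P1 - P2 = a1 *: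
  Q1 - a2 *: Q2 ->
    P1@_m - P2@_m = a1 * Q1@_m - a2 * Q2@_m.
  by move/(congr1 (mcoeff m)); rewrite !mcoeffB !mcoeffZ.
have := coefE _ _ _ _ _ _ (e c) (ind_polar_comm M_inj M_deg M_onto p q i j 'X_[e
  b]).
rewrite [p == j]eq_sym => h.
apply: etrans (subE _ _) _; apply: etrans (congr2 (fun x y =>
  x - y) (rowE _ _ _ _) (rowE _ _ _ _)) _.
apply: etrans h _; apply/esym; apply: etrans (subE _ _) _.
by congr (_ - _); exact: scaleE.
Qed.

Lemma polar_mx_diag i : polar_mx i i = diag_mx (\row_b (weight_of M (e b)
  i)%:R).
Proof.
apply/matrixP => b c; rewrite !mxE ind_polar_diagX // mcoeffZ mcoeffX (inj_eq
  e_inj).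
by rewrite mulr_natr.
Qed.

(** The squared norms of monomials in the symmetric algebra of the space of
    forms, the latter with its own Fischer form. *)
Definition fischer b : K := (mfact (e b) * \prod_u mfact (M u) ^ (e b u))%:R.

Lemma fischer_gt0 b : 0 < fischer b.
Proof.
rewrite ltr0n muln_gt0 mfact_gt0 prodn_gt0 // => u.
by rewrite expn_gt0 mfact_gt0.
Qed.

(** The adjunction [polar_adj] is used twice: in the coefficients, for the
    operators a_v d/da_u, and in the x_i, for the matrix coefficients of a
    polarization. *)
Lemma polar_mx_adj i j b c : polar_mx i j b c * fischer c = fischer b *
  (polar_mx j i c b)^*.
Proof.
have -> : (polar_mx j i c b)^* = polar_mx j i c b.
  rewrite mxE ind_polarE; elim/big_rec: _ => [|u P _ IHP];
    first by rewrite mcoeff0 conjC0.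
  rewrite mcoeffD rmorphD /= IHP; congr (_ + _).
  elim/big_rec: _ => [|v Q _ IHQ]; first by rewrite mcoeff0 conjC0.
  rewrite mcoeffD rmorphD /= IHQ; congr (_ + _).
  by rewrite mcoeffZ !mcoeff_polarX -natrM conjC_nat.
rewrite !mxE !ind_polarE !raddf_sum /= mulr_sumr mulr_suml.
under eq_bigr do rewrite raddf_sum mulr_suml.
under [RHS]eq_bigr do rewrite raddf_sum mulr_sumr.
rewrite exchange_big; apply: eq_bigr => v _; apply: eq_bigr => u _ /=.
pose w b := (\prod_u mfact (M u) ^ (e b u))%N.
rewrite !mcoeffZ /fischer -/(w b) -/(w c) !natrM.
set s := (polar i j _)@_ _; set t := (polar j i _)@_ _.
set o := (polar u v _)@_ _.
have oE : o * (mfact (e c))%:R = _ := polar_adj _ u v _ _.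
have sE : s * (mfact (M v))%:R = t * (mfact (M u))%:R := polar_adj _ i j _ _.
set o' := (polar v u _)@_ _ in oE *.
have natP (x : nat) : (0 < x)%N -> x%:R != 0 :> K by rewrite pnatr_eq0 lt0n.
have [o0|o0] := eqVneq o 0.
  have /eqP : o' * (mfact (e b))%:R = 0 by rewrite -oE o0 mul0r.
  by rewrite mulf_eq0 (negbTE (natP _ (mfact_gt0 _))) orbF => /eqP ->;
    rewrite o0 !(mulr0, mul0r).
have bc : (e b + U_(v) = e c + U_(u))%MM.
  by move: o0; rewrite /o mcoeff_polarX pnatr_eq0 muln_eq0 negb_or eqb0 negbK =>
    /andP [_ /eqP].
have wD m x : (\prod_y mfact (M y) ^ (m + U_(x))%MM y = (\prod_y mfact (M y) ^ m
  y) * mfact (M x))%N.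
  under eq_bigr do rewrite mnmDE expnD.
  rewrite big_split /=; congr (_ * _)%N; rewrite (bigD1 x) //= mnm1E eqxx expn1.
  by rewrite big1 ?muln1 // => y /negbTE yx; rewrite mnm1E eq_sym yx.
have wE : ((w c)%:R * (mfact (M u))%:R = (w b)%:R * (mfact (M v))%:R :> K).
  by rewrite -!natrM -!wD bc.
apply: (mulIf (natP _ (mfact_gt0 (M v)))).
transitivity ((s * (mfact (M v))%:R) * (o * (mfact (e c))%:R) * (w c)%:R);
  first by ring.
rewrite sE oE.
transitivity (t * (o' * (mfact (e b))%:R) * ((w c)%:R * (mfact (M u))%:R));
  first by ring.
by rewrite wE; ring.
Qed.

End Matrix.

(** * Generation of the special linear group by transvections *)

Definition transvection (K : fieldType) n (t : K) (l j : 'I_n) : 'M[K]_n := 1%:M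
  + t *: delta_mx l j.

Section Transvections.
Variable K : fieldType.

Lemma transvectionK n t (l j : 'I_n) : l != j ->
  transvection (- t) l j *m transvection t l j = 1%:M :> 'M[K]_n.
Proof.
move=> lj; rewrite /transvection mulmxDl mul1mx mulmxDr mulmx1 -scalemxAl
  -scalemxAr.
by rewrite mul_delta_mx_0 1?eq_sym // !scaler0 addr0 scaleNr addrK.
Qed.

Lemma det_transvection n (t : K) (l j : 'I_n) : l != j ->
  \det (transvection t l j) = 1.
Proof.
move=> lj.
have trig (a b : 'I_n) : (b < a)%N -> \det (transvection t a b) = 1.
  move=> ba; rewrite det_trig.
    rewrite big1 // => i _; rewrite !mxE eqxx; case: (i =P a) => [->|];
      last by rewrite mulr0 addr0.
    by rewrite -val_eqE /= eq_sym (ltn_eqF ba) mulr0 addr0.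
  apply/is_trig_mxP => i k ik; rewrite !mxE -val_eqE /= (ltn_eqF ik).
  case: (i =P a) => [ia|]; last by rewrite mulr0 addr0.
  case: (k =P b) => [kb|]; last by rewrite andbF mulr0 addr0.
  by move: ik; rewrite ia kb ltnNge ltnW.
case: (ltngtP j l) => [/trig //|jl|/val_inj e]; last by rewrite e eqxx in lj.
rewrite -det_tr (_ : (transvection t l j)^T = transvection t j l) ?trig //.
by rewrite /transvection linearD /= tr_scalar_mx linearZ /= trmx_delta.
Qed.

(** Gaussian elimination. If an entry below the corner is nonzero, then a
    transvection changes the corner to 1. A matrix with corner 1 is the
    product of a lower unipotent, a block diagonal and an upper unipotent
    matrix. *)
Lemma transvection_ind n (S : 'M[K]_n -> Prop) :
  S 1%:M -> (forall g h, S g -> S h -> S (g *m h)) ->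
  (forall t l j, l != j -> S (transvection t l j)) ->
  forall g, \det g = 1 -> S g.
Proof.
elim: n => [|n IHn] in S *; first by move=> S1 _ _ g _;
  have -> : g = 1%:M by apply/matrixP => -[].
rewrite -[n.+1]/(1 + n)%N in S *; move=> S1 SM ST.
have red g t l j : l != j -> S (transvection t l j *m g) -> S g.
  move=> lj Sg; rewrite -[g]mul1mx -(transvectionK t lj) -mulmxA.
  by apply: (SM) Sg; apply: (ST).
have unip (c : 'I_n -> K) (l j : 'I_n -> 'I_(1 + n)) : (forall i k,
  l i != j k) ->
    S (1%:M + \sum_i c i *: delta_mx (l i) (j i)).
  move=> lj; set X := \sum_i _.
  suff [] : S (1%:M + X) /\ forall k, X *m delta_mx (l k) (j k) = 0 by [].
  rewrite /X; elim/big_rec: _ => [|i Y _ [SY Y0]].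
    by rewrite addr0; split=> // k; rewrite mul0mx.
  split=> [|k]; last first.
    by rewrite mulmxDl Y0 addr0 -scalemxAl mul_delta_mx_0 ?scaler0 // eq_sym.
  rewrite (_ : _ + _ = (1%:M + Y) *m transvection (c i) (l i) (j i)).
    by apply: (SM) => //; apply: (ST).
  rewrite /transvection mulmxDl mul1mx mulmxDr mulmx1 -scalemxAr Y0 scaler0
    addr0.
  by rewrite -addrA.
pose ext := @block_mx K 1 n 1 n 1%:M 0 0.
have S' (B : 'M[K]_n) : \det B = 1 -> S (ext B).
  move: B; apply: (IHn (fun B => S (ext B))).
  - by rewrite /ext -scalar_mx_block.
  - move=> B B' SB SB'.
    suff -> : ext (B *m B') = ext B *m ext B' :> 'M[K]_(1 + n).
      exact: SM.
    by rewrite /ext mulmx_block !mul0mx !mulmx0 !mul1mx !add0r !addr0.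
  - move=> t l j lj.
    have -> : ext (transvection t l j) = transvection t (rshift 1 l) (rshift 1
      j) :> 'M[K]_(1 + n).
      rewrite /ext /transvection (scalar_mx_block 1 n) -[delta_mx (rshift 1 l)
        _]submxK.
      rewrite scale_block_mx add_block_mx; congr block_mx; apply/matrixP => x y;
        by rewrite !mxE ?(eq_rshift, eq_lrshift,
          eq_rlshift) /= ?andbF ?mulr0 ?addr0.
    by apply: (ST); apply: contraNneq lj => /(congr1 val) [] /val_inj ->.
have lowS (c : 'cV[K]_n) : S (@block_mx K 1 n 1 n 1%:M 0 c 1%:M).
  have := unip (fun i => c i 0) (@rshift 1 n) (fun=> @lshift 1 n 0) (fun i k =>
    negbT (@eq_rlshift 1 n _ _)).
  congr S; set X := \sum_i _; rewrite (scalar_mx_block 1 n) -[X]submxK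
    add_block_mx.
  congr block_mx; apply/matrixP => x y; rewrite !mxE summxE.
  - rewrite big1 ?addr0 // => i _; by rewrite !mxE eq_lrshift mulr0.
  - rewrite big1 ?addr0 // => i _; by rewrite !mxE eq_lrshift mulr0.
  - rewrite add0r (bigD1 x) //= !mxE !eqxx /= [y]ord1 eqxx mulr1 big1 ?addr0 //
    => i ix.
    by rewrite !mxE eq_rshift eq_sym (negbTE ix) mulr0.
  - rewrite big1 ?addr0 // => i _; by rewrite !mxE eq_rlshift andbF mulr0.
have upS (c : 'rV[K]_n) : S (@block_mx K 1 n 1 n 1%:M c 0 1%:M).
  have := unip (fun i => c 0 i) (fun=> @lshift 1 n 0) (@rshift 1 n) (fun i k =>
    negbT (@eq_lrshift 1 n _ _)).
  congr S; set X := \sum_i _; rewrite (scalar_mx_block 1 n) -[X]submxK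
    add_block_mx.
  congr block_mx; apply/matrixP => x y; rewrite !mxE summxE.
  - rewrite big1 ?addr0 // => i _; by rewrite !mxE eq_lrshift andbF mulr0.
  - rewrite add0r (bigD1 y) //= !mxE !eqxx /= [x]ord1 eqxx mulr1 big1 ?addr0 //
    => i ix.
    by rewrite !mxE eq_rshift [y == i]eq_sym (negbTE ix) andbF mulr0.
  - rewrite big1 ?addr0 // => i _; by rewrite !mxE eq_rlshift mulr0.
  - rewrite big1 ?addr0 // => i _; by rewrite !mxE eq_rlshift mulr0.
have S00 (g : 'M[K]_(1 + n)) : g 0 0 = 1 -> \det g = 1 -> S g.
  move=> g00 dg; pose B := drsubmx g - dlsubmx g *m ursubmx g.
  have gE : g = @block_mx K 1 n 1 n 1%:M 0 (dlsubmx g) 1%:M *m ext B *m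
                @block_mx K 1 n 1 n 1%:M (ursubmx g) 0 1%:M.
    rewrite /ext !mulmx_block !(mul0mx, mulmx0, mul1mx, mulmx1, add0r, addr0).
    rewrite /B addrC subrK -[LHS]submxK; congr block_mx.
    by apply/matrixP => x y; rewrite [x]ord1 [y]ord1 !mxE -g00; congr (g _ _);
      apply: val_inj.
  rewrite gE; apply: (SM) => //; apply: (SM) => //; apply: (S').
  move: dg; rewrite gE !det_mulmx det_lblock det_ublock /ext det_ublock !det1.
  by rewrite !mul1r mulr1.
have Si (g : 'M[K]_(1 + n)) (i : 'I_(1 + n)) : i != 0 -> g i 0 != 0 ->
  \det g = 1 -> S g.
  move=> i0 gi dg; apply: (red _ ((1 - g 0 0) / g i 0) 0 i);
    first by rewrite eq_sym.
  apply: S00; last by rewrite det_mulmx det_transvection 1?eq_sym // mul1r.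
  rewrite /transvection mulmxDl mul1mx -scalemxAl !mxE (bigD1 i) //= !mxE !eqxx
    mul1r.
  rewrite big1 ?addr0 => [|k ki]; last by rewrite !mxE (negbTE ki) andbF mul0r.
  by rewrite divfK // addrC subrK.
move=> g dg; have [i /andP [i0 gi]|g0] := pickP (fun i : 'I_(1 + n) =>
  (i != 0) && (g i 0 != 0)).
  exact: (Si g i).
have dE : \det g = g 0 0 * cofactor g 0 0.
  rewrite (expand_det_col g 0) (bigD1 0) //= big1 ?addr0 // => i i0.
  by have := g0 i; rewrite i0 /= => /negbFE/eqP ->; rewrite mul0r.
case: n => [|n] in IHn S S1 SM ST red unip ext S' lowS upS S00 Si g dg g0 dE *.
  by apply: S00 => //; rewrite -dg det_mx11.
have g00 : g 0 0 != 0 by apply: contraPneq dg => g00;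
  rewrite dE g00 mul0r => /eqP; rewrite eq_sym oner_eq0.
apply: (red g 1 1 0) => //; apply: (Si _ 1) => //.
  rewrite /transvection mulmxDl mul1mx scale1r !mxE (bigD1 0) //= !mxE !eqxx
    mul1r.
  rewrite big1 ?addr0 => [|k ki]; last by rewrite !mxE (negbTE ki) andbF mul0r.
  by have := g0 1; rewrite /= => /negbFE/eqP ->; rewrite add0r.
by rewrite det_mulmx det_transvection // mul1r.
Qed.
End Transvections.

(** * Differentiation along transvections *)

Lemma rmorph_mmap (K S S' : comNzRingType) (n : nat) (f : {rmorphism K -> S})
    (g : {rmorphism K -> S'}) (h : 'I_n -> S) (h' : 'I_n ->
      S') (phi : {rmorphism S -> S'}) :
  (forall c, phi (f c) = g c) -> (forall i, phi (h i) = h' i) ->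
  forall P : {mpoly K[n]}, phi (mmap f h P) = mmap g h' P.
Proof.
move=> fg hh'; elim/mpoly_alg_ind => [c|i|P Q IHP IHQ|P Q IHP IHQ].
- by rewrite !mmapC fg.
- by rewrite !mmapX !mmap1U hh'.
- by rewrite !mmapD rmorphD IHP IHQ.
- by rewrite !rmorphM /= IHP IHQ.
Qed.

Section CharZero.
Variable K : numFieldType.

Lemma deriv_eq0 (f : {poly K}) : f^`() = 0 -> f = (f.[0])%:P.
Proof.
move=> f'0; apply/polyP => -[|i]; first by rewrite coefC /= horner_coef0.
rewrite coefC /=; have := congr1 (fun p : {poly K} => p`_i) f'0.
by rewrite coef_deriv coef0 => /eqP; rewrite mulrn_eq0 /= => /eqP.
Qed.

Lemma poly_eq0 (f : {poly K}) : (forall t, f.[t] = 0) -> f = 0.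
Proof.
move=> f0; apply/eqP/negPn/negP => fn0.
have := @max_poly_roots K f [seq i%:R | i <- iota 0 (size f)] fn0.
rewrite size_map size_iota ltnn => h; suff // : false by [].
apply: h; first by apply/allP => x _; apply/rootP.
by rewrite map_inj_uniq ?iota_uniq // => i j /eqP; rewrite eqr_nat => /eqP.
Qed.

Lemma mmap_horner (n : nat) (h : 'I_n -> {poly K}) (P : {mpoly K[n]}) t :
  (mmap polyC h P).[t] = P.@[fun i => (h i).[t]].
Proof.
rewrite -[LHS]/(horner_eval t _) /meval.
apply: (@rmorph_mmap K {poly K} K n polyC idfun h _ (horner_eval t)) => [c|i];
  by rewrite /= /horner_eval ?hornerC.
Qed.

Lemma deriv_mmap (n : nat) (h : 'I_n -> {poly K}) (P : {mpoly K[n]}) :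
  (mmap polyC h P)^`() = \sum_i mmap polyC h P^`M(i) * (h i)^`().
Proof.
exact: (@chain_rule _ _ _ polyC h deriv P (@derivM _) (@derivC _)).
Qed.

Lemma meval_at0 (n : nat) (P : {mpoly K[n]}) : P.@[fun _ => 0] = P@_0%MM.
Proof.
elim/mpoly_alg_ind: P => [c|i|P Q IHP IHQ|P Q IHP IHQ].
- by rewrite mevalC mcoeffC eqxx mulr1.
- by rewrite mevalXU mcoeffX mnm1_eq0.
- by rewrite mevalD mcoeffD IHP IHQ.
- by rewrite mevalM rmorphM /= IHP IHQ.
Qed.

(** Differentiation along coordinate lines shows that the partial derivatives
    vanish everywhere, too; the coefficient of a monomial is then found by
    induction on its degree. *)
Lemma mpoly_eq0 (n : nat) (P : {mpoly K[n]}) : (forall a, P.@[a] = 0) -> P = 0.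
Proof.
move=> P0; apply/mpolyP => m; rewrite mcoeff0.
have [k] := ubnP (mdeg m); elim: k => // k IH in P m P0 *; rewrite ltnS => mk.
have dP0 i a : P^`M(i).@[a] = 0.
  pose h j : {poly K} := (a j)%:P + (j == i)%:R *: 'X.
  have f0 : mmap polyC h P = 0 by apply: poly_eq0 => t; rewrite mmap_horner.
  have /(congr1 (fun p : {poly K} => p.[0])) := deriv_mmap h P.
  rewrite f0 linear0 horner0 (bigD1 i) //= big1 ?addr0 => [|j /negbTE ji].
    have -> : (h i)^`() = 1 by rewrite /h derivD derivC add0r derivZ derivX eqxx
      scale1r.
    rewrite mulr1 mmap_horner => e; rewrite [RHS]e.
    by apply: meval_eq => j; rewrite !hornerE.
  by rewrite /h derivD derivC add0r derivZ derivX ji scale0r mulr0.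
have [->|/eqP mn0] := eqVneq m 0%MM; first by rewrite -meval_at0.
have [i mi] : exists i, m i != 0%N.
  by apply/existsP; apply: contra_notT mn0 => /existsPn mi; apply/mnmP => i;
    rewrite mnm0E; apply/eqP/negPn/mi.
move: mi mk; rewrite -lep1mP => /submK <-; rewrite mdegD mdeg1 addn1 => mk.
have := IH _ _ (dP0 i) mk; rewrite mcoeff_deriv => /eqP.
by rewrite mulrn_eq0 /= => /eqP.
Qed.

End CharZero.

Section Curve.
Variables (K : numFieldType) (n : nat) (t : K) (l j : 'I_n).
Hypothesis lj : l != j.
Notation KT := {poly K}.

Lemma map_deriv_mul (P Q : {mpoly KT[n]}) :
  map_mpoly deriv (P * Q) = map_mpoly deriv P * Q + P * map_mpoly deriv Q.
Proof.
apply/mpolyP => m; rewrite mcoeffD mcoeff_map_mpoly !mcoeffM (raddf_sum deriv)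
  -big_split.
by apply: eq_bigr => k _ /=; rewrite derivM !mcoeff_map_mpoly.
Qed.

Lemma map_derivX r : map_mpoly deriv ('X_r : {mpoly KT[n]}) = 0.
Proof.
apply/mpolyP => m; rewrite mcoeff_map_mpoly mcoeffX mcoeff0 /=.
by rewrite -polyC_natr derivC.
Qed.

(** The variables after a transvection whose parameter is the indeterminate of
    the ring of coefficients. *)
Definition gen_var (r : 'I_n) : {mpoly KT[n]} :=
  'X_r + ((r == j)%:R *: 'X)%:MP * 'X_l.

Definition gen_subst (F : {mpoly K[n]}) : {mpoly KT[n]} := mmap (@mpolyC n KT \o
  polyC) gen_var F.

(** Differentiation in the parameter and polarization are both derivations,
    and they agree on the transformed variables. *)
Lemma deriv_gen_subst F : map_mpoly deriv (gen_subst F) = polar j l (gen_subst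
  F).
Proof.
rewrite /gen_subst.
have -> := @chain_rule _ _ _ (@mpolyC n KT \o polyC) gen_var (map_mpoly deriv) F
  map_deriv_mul.
  have -> := @chain_rule _ _ _ (@mpolyC n KT \o polyC) gen_var (polar j l) F.
  - apply: eq_bigr => r _; congr (_ * _).
    rewrite /gen_var (raddfD (map_mpoly deriv)) /= map_deriv_mul map_derivX
      add0r map_mpolyC map_derivX mulr0 addr0.
    rewrite /polar mderivD mderivM mderivC mul0r add0r !mderivXU [j == l]eq_sym
      (negbTE lj) mulr0 addr0.
    by rewrite mulrC /= derivZ derivX eq_sym alg_polyC rmorph_nat mpolyC_nat.
  - by move=> x y; rewrite /= /polar mderivM; ring.
  - by move=> c; rewrite /= /polar mderivC mulr0.
by move=> c; rewrite /= map_mpolyC /= derivC mpolyC0.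
Qed.

Lemma gen_subst_eval F : map_mpoly (horner_eval t) (gen_subst F) =
  F \mPo [tuple \sum_i (transvection t l j) i r *: 'X_i | r < n].
Proof.
apply: (@rmorph_mmap _ _ _ _ _ (@mpolyC n K) _ _ (map_mpoly (horner_eval t))) =>
  [c|r].
  by rewrite /= map_mpolyC /= /horner_eval hornerC.
rewrite /gen_var rmorphD rmorphM /= !map_mpolyX map_mpolyC tnth_mktuple.
under eq_bigr do rewrite /transvection !mxE scalerDl.
rewrite big_split /= (bigD1 r) //= eqxx scale1r big1 ?addr0 => [|i /negbTE ->];
  last by rewrite scale0r.
congr (_ + _); rewrite (bigD1 l) //= eqxx big1 ?addr0 => [|i /negbTE ->];
  last by rewrite mulr0 scale0r.
by rewrite mul_mpolyC /horner_eval hornerZ hornerX mulrC.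
Qed.

Lemma gen_subst_coef F m : ((gen_subst F)@_m).[t] =
  (F \mPo [tuple \sum_i (transvection t l j) i r *: 'X_i | r < n])@_m.
Proof. by rewrite -gen_subst_eval; exact/esym/(mcoeff_map_mpoly (horner_eval
  t)). Qed.

(** The derivative of the curve of coefficients of a form is a polarization of
    the form, which [polar_adj_sum] moves to the symbols. *)
Lemma transvection_curve (d N : nat) (M : 'I_N ->
  'X_{1..n}) (F : {mpoly K[n]}) :
  injective M -> (forall u, mdeg (M u) = d) -> (forall m, mdeg m = d ->
    exists u, M u = m) ->
  let h u := ((mfact (M u))%:R / d`!%:R)%:P * (gen_subst F)@_(M u) in
  forall P, (mmap polyC h P)^`() = mmap polyC h (ind_polar M l j P).
Proof.
move=> M_inj M_deg M_onto h P.
have sumE I (r : seq I) (f : I -> {mpoly K[N]}) :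
  mmap polyC h (\sum_(i <- r) f i) = \sum_(i <- r) mmap polyC h (f i) by exact:
    raddf_sum.
rewrite deriv_mmap /ind_polar sumE; apply: eq_bigr => u _.
rewrite rmorphM mulrC /=; congr (_ * _).
rewrite /umbra sumE {1}/h derivM derivC mul0r add0r.
have -> : ((gen_subst F)@_(M u))^`() = (polar j l (gen_subst F))@_(M u).
  by rewrite -deriv_gen_subst; exact/esym/(mcoeff_map_mpoly deriv).
have := polar_adj_sum M_inj M_deg M_onto j l (gen_subst F) u.
move=> e; rewrite polyCM [LHS]mulrC mulrA polyC_natr {}e.
rewrite mulr_suml; apply: eq_bigr => v _.
rewrite mmapZ mmapX mmap1U /h -polyC_natr polyCM !mcoeff_polarX -!polyC_natr.
by ring.
Qed.

End Curve.

(** * Invariance in terms of polarizations *)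

Section Invariance.
Variables (R : realType) (n d : nat).
Hypothesis n_gt0 : (0 < n)%N.
Local Notation C := R[i].
Local Notation N := (ncoef n d).

Definition ind_rank (i : Ind n d) : 'I_N := cast_ord (esym (ncoefE n d))
  (enum_rank i).

Lemma ind_rankK : cancel ind_rank (@coef_ind n d).
Proof. by move=> i; rewrite /coef_ind /ind_rank cast_ordKV enum_rankK. Qed.

Lemma coef_indK : cancel (@coef_ind n d) ind_rank.
Proof. by move=> u; rewrite /coef_ind /ind_rank enum_valK cast_ordK. Qed.

Definition coef_exp (u : 'I_N) : 'X_{1..n} := form_mon (coef_ind u).

Definition form_polar := @ind_polar C n N coef_exp.

Lemma coef_exp_inj : injective coef_exp.
Proof. by move=> u v /(form_mon_inj n_gt0) /(can_inj coef_indK). Qed.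

Lemma coef_exp_deg u : mdeg (coef_exp u) = d.
Proof. exact: mdeg_form_mon. Qed.

Lemma coef_exp_onto m : mdeg m = d -> exists u, coef_exp u = m.
Proof.
by move=> /(form_mon_onto n_gt0) [i <-]; exists (ind_rank i);
  rewrite /coef_exp ind_rankK.
Qed.

Lemma multibinE (i : Ind n d) : multibin R i = d`!%:R / (mfact (form_mon i))%:R.
Proof.
rewrite /multibin /mfact; congr (_ / _%:R); case: n n_gt0 i => // n' _ i.
rewrite big_ord_recl mulnC mnmE /=; congr (_ * _)%N.
by apply: eq_bigr => r _; rewrite mnmE /= (mnm_nth 0%N).
Qed.

Lemma change_vars1 (F : {mpoly C[n]}) : change_vars 1%:M F = F.
Proof.
rewrite /change_vars -[RHS]comp_mpoly_id; congr (comp_mpoly _ F).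
apply: eq_from_tnth => r; rewrite !tnth_mktuple (bigD1 r) //= mxE eqxx scale1r.
by rewrite big1 ?addr0 // => i /negbTE ir; rewrite mxE ir scale0r.
Qed.

Section Transvection.
Variables (l j : 'I_n) (lj : l != j) (a : Ind n d -> C).

Definition curve (u : 'I_N) : {poly C} :=
  ((mfact (coef_exp u))%:R / d`!%:R)%:P * (gen_subst l j (Defs.form
    a))@_(coef_exp u).

Lemma curve_value P t : (mmap polyC curve P).[t] =
  value P (form_coef (change_vars (transvection t l j) (Defs.form a))).
Proof.
rewrite mmap_horner; apply: meval_eq => u.
rewrite hornerM hornerC mulrC /form_coef multibinE invf_div; congr (_ * _).
exact: (gen_subst_coef t l j (Defs.form a)).
Qed.

Lemma curve0 P : (mmap polyC curve P).[0] = value P a.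
Proof.
rewrite curve_value /transvection scale0r addr0 change_vars1.
by apply: meval_eq => u; rewrite formK.
Qed.

Lemma deriv_curve P : (mmap polyC curve P)^`() = mmap polyC curve (form_polar l
  j P).
Proof. exact: (transvection_curve lj (Defs.form a) coef_exp_inj coef_exp_deg
  coef_exp_onto P). Qed.

End Transvection.

(** An invariant is constant along the curve through each form, and its
    derivative at 0 is the value of its polarization at the form. *)
Lemma invariant_polar_eq0 (P : {mpoly C[N]}) (l j : 'I_n) : is_invariant P ->
  l != j -> form_polar l j P = 0.
Proof.
move=> invP lj; apply: mpoly_eq0 => v.
pose a i := v (ind_rank i).
have -> : (form_polar l j P).@[v] = value (form_polar l j P) a.
  by apply: meval_eq => u; rewrite /a coef_indK.
rewrite -(curve0 l j) -deriv_curve //.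
have -> : mmap polyC (curve l j a) P = (value P a)%:P.
  apply/eqP; rewrite -subr_eq0; apply/eqP/poly_eq0 => t.
  rewrite hornerD hornerN hornerC curve_value invP ?subrr //.
  exact: det_transvection.
by rewrite derivC horner0.
Qed.

Lemma change_varsM (g h : 'M[C]_n) (F : {mpoly C[n]}) :
  change_vars (g *m h) F = change_vars g (change_vars h F).
Proof.
have := @rmorph_mmap _ _ _ n (@mpolyC n C) (@mpolyC n C) _
  (tnth [tuple \sum_l (g *m h) l j *: 'X_l | j < n])
  (comp_mpoly [tuple \sum_l g l j *: 'X_l | j < n]).
move=> h1; symmetry; apply: h1 => [c|i]; first by rewrite /= comp_mpolyC.
rewrite !tnth_mktuple raddf_sum /=.
under eq_bigr => l _ do rewrite comp_mpolyZ comp_mpolyXU -tnth_nth tnth_mktuple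
  scaler_sumr.
rewrite exchange_big; apply: eq_bigr => r _ /=; rewrite mxE scaler_suml.
by apply: eq_bigr => l _; rewrite scalerA mulrC.
Qed.

Lemma change_vars_homog (g : 'M[C]_n) (F : {mpoly C[n]}) : F \is d.-homog ->
  change_vars g F \is d.-homog.
Proof.
move=> Fd; rewrite (mpolyE F) /change_vars raddf_sum big_seq;
  apply: rpred_sum => m /(dhomog_mf Fd) /= <-.
rewrite comp_mpolyZ; apply: rpredZ; rewrite comp_mpolyX mdegE.
elim/big_rec2: _ => [|i y x _ Hx]; first exact: dhomog1.
apply: dhomogM => //; rewrite tnth_mktuple.
rewrite -[X in X.-homog]mul1n; apply: dhomogMn.
by apply: rpred_sum => l _; apply: rpredZ; rewrite dhomogX /= mdeg1.
Qed.

(** The derivative along each transvection subgroup is zero, and transvections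
    generate SL_n. *)
Lemma polar_eq0_invariant (P : {mpoly C[N]}) : (forall l j : 'I_n, l != j ->
  form_polar l j P = 0) -> is_invariant P.
Proof.
move=> P0; pose fixes g := forall a : Ind n d -> C,
  value P (form_coef (change_vars g (Defs.form a))) = value P a.
suff fixesP : forall g, \det g = 1 -> fixes g by [].
apply: (transvection_ind (S := fixes)).
- move=> a; rewrite change_vars1; apply: meval_eq => u; exact: formK.
- move=> g h Sg Sh a; rewrite change_varsM.
  have hd : change_vars h (Defs.form a) \is d.-homog.
    by apply: change_vars_homog; apply: form_homog.
  by rewrite -(form_coefK n_gt0 hd) Sg Sh.
- move=> t l j lj a.
  rewrite -curve_value -(curve0 l j a).
  have : (mmap polyC (curve l j a) P)^`() = 0 by rewrite deriv_curve // P0 //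
    raddf0.
  by move/deriv_eq0 => ->; rewrite !hornerC.
Qed.

End Invariance.

(** * The dimension of the space of invariants *)

Lemma dim_rank (K : fieldType) (V : vectType K) (r : nat) (f : {linear V ->
  'rV[K]_r})
    (U : {vspace V}) (B : 'M[K]_r) :
  injective f -> (forall w, exists v, f v = w) ->
  (forall v, v \in U <-> (f v <= B)%MS) -> \dim U = \rank B.
Proof.
move=> f_inj f_onto UB; pose X := vbasis U.
pose Y : 'M[K]_(\dim U, r) := \matrix_(i < \dim U) f X`_i.
have rowY i : row i Y = f X`_i by rewrite rowK.
have mulY (w : 'rV[K]_(\dim U)) : w *m Y = f (\sum_i w 0 i *: X`_i).
  rewrite mulmx_sum_row linear_sum; apply: eq_bigr => i _.
  by rewrite linearZ /= rowY.
have Yfree : row_free Y.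
  rewrite -kermx_eq0; apply/rowV0P => w /sub_kermxP;
    rewrite mulY -(linear0 f) => /f_inj w0.
  have /freeP/(_ (fun i => w 0 i) w0) h := basis_free (vbasisP U).
  by apply/rowP => i; rewrite h mxE.
have YB : (Y == B)%MS.
  apply/andP; split; apply/row_subP => i.
    by rewrite rowY; apply/UB/vbasis_mem/mem_nth; rewrite size_tuple.
  have [v vE] := f_onto (row i B); rewrite -vE.
  have Uv : v \in U by apply/UB; rewrite vE row_sub.
  rewrite (coord_vbasis Uv); apply/submxP; exists (\row_i coord X i v).
  by rewrite mulY; congr (f _); apply: eq_bigr => j _; rewrite mxE.
by rewrite -(eqmxP YB); apply/esym/eqP.
Qed.

Section OffDiagonal.
Variables (K : numFieldType) (n r N : nat) (E : 'I_n -> 'I_n -> 'M[K]_r).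
Hypothesis commE : forall i j k l, E i j *m E k l - E k l *m E i j =
  (j == k)%:R *: E i l - (i == l)%:R *: E k j.
Hypothesis sumE : \sum_i E i i = N%:R%:M.

(** The commutators of [E i j] and [E j i] show that all [E i i] act on [v] in
    the same way. *)
Lemma offdiag_trace (v : 'rV[K]_r) i : (forall i j, i != j -> v *m E i j = 0) ->
  n%:R *: (v *m E i i) = N%:R *: v.
Proof.
move=> v0; have vE j : v *m E i i = v *m E j j.
  have [->//|ij] := eqVneq i j.
  have /(congr1 (mulmx v)) := commE i j j i.
  rewrite !eqxx !scale1r !mulmxBr !mulmxA (v0 i j ij) (v0 j i) 1?eq_sym //
    !mul0mx subrr.
  by move/esym/eqP; rewrite subr_eq0 => /eqP.
transitivity (\sum_j v *m E j j).
  by under eq_bigr do rewrite -vE; rewrite sumr_const card_ord scaler_nat.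
by rewrite -mulmx_sumr sumE mul_mx_scalar.
Qed.

End OffDiagonal.

Section Count.
Variables (R : realType) (n d k : nat).
Hypothesis n_gt0 : (0 < n)%N.
Local Notation C := R[i].
Local Notation N := (ncoef n d).

Local Notation expo := (@coef_exp n d).

(** The families counted by c_{n,d}(k, mu), before the conditions on their
    weight. *)
Definition families : {set {ffun Ind n d -> 'I_k.+1}} := [set al : {ffun Ind n d
  -> 'I_k.+1} | (\sum_i al i == k)%N].

Definition fam_mon (al : {ffun Ind n d -> 'I_k.+1}) : 'X_{1..N} :=
  [multinom (al (coef_ind u) : nat) | u < N].

(** The weight for gl_n, of which mu records the differences of consecutive
    coordinates. *)
Definition fam_weight (al : {ffun Ind n d -> 'I_k.+1}) : 'X_{1..n} :=
  (\sum_i form_mon i *+ al i)%MM.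

Lemma coef_ind_bij : bijective (@coef_ind n d).
Proof. by exists (@ind_rank n d); [exact: coef_indK | exact: ind_rankK]. Qed.

Lemma mdeg_fam_mon al : mdeg (fam_mon al) = (\sum_i al i)%N.
Proof.
rewrite mdegE [RHS](reindex (@coef_ind n d)) /=;
  last exact/onW_bij/coef_ind_bij.
by apply: eq_bigr => u _; rewrite mnmE.
Qed.

Lemma fam_weightE al : weight_of expo (fam_mon al) = fam_weight al.
Proof.
rewrite /fam_weight (reindex (@coef_ind n d)) /=;
  last exact/onW_bij/coef_ind_bij.
by apply: eq_bigr => u _; rewrite mnmE.
Qed.

Lemma fam_mon_inj : injective fam_mon.
Proof.
move=> al be /mnmP e; apply/ffunP => i; apply: val_inj.
by have := e (ind_rank i); rewrite !mnmE ind_rankK.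
Qed.

Lemma fam_mon_onto m : mdeg m = k -> exists2 al,
  al \in families & fam_mon al = m.
Proof.
move=> mk; have le u : (m u < k.+1)%N.
  by rewrite ltnS -mk mdegE (bigD1 u) //= leq_addr.
have famE : fam_mon [ffun i => Ordinal (le (ind_rank i))] = m.
  by apply/mnmP => u; rewrite mnmE ffunE /= coef_indK.
exists [ffun i => Ordinal (le (ind_rank i))] => //.
by rewrite inE -mdeg_fam_mon famE mk.
Qed.

Definition fam_exp (b : 'I_#|families|) : 'X_{1..N} := fam_mon (enum_val b).

Lemma fam_exp_inj : injective fam_exp.
Proof. by move=> b c /fam_mon_inj /enum_val_inj. Qed.

Lemma fam_exp_deg b : mdeg (fam_exp b) = k.
Proof. by rewrite mdeg_fam_mon; apply/eqP; have := enum_valP b;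
  rewrite inE. Qed.

Lemma fam_exp_onto m : mdeg m = k -> exists b, fam_exp b = m.
Proof.
move=> /fam_mon_onto [al alP <-]; exists (enum_rank_in alP al).
by rewrite /fam_exp enum_rankK_in.
Qed.

Definition polarization i j : 'M[C]_#|families| := @polar_mx C n N _ expo
  fam_exp i j.

Lemma invariants_coords (P : dhomog N C k) : P \in invariants R n d k <->
  forall i j : 'I_n, i != j -> coords fam_exp (val P) *m polarization i j = 0.
Proof.
rewrite invariantsP; have Pk : (val P) \is k.-homog := valP P.
have polk i j : ind_polar expo i j (val P) \is k.-homog by apply:
  ind_polar_homog.
have cE i j : coords fam_exp (ind_polar expo i j (val P)) = coords fam_exp (val
  P) *m polarization i j.
  exact: (coords_ind_polar expo fam_exp_inj fam_exp_deg fam_exp_onto i j Pk).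
split=> [invP i j ij|P0].
  by rewrite -cE [ind_polar _ _ _ _](invariant_polar_eq0 n_gt0 invP ij) linear0.
apply: polar_eq0_invariant => // i j ij.
apply: (coords_inj fam_exp_inj fam_exp_deg fam_exp_onto (polk i j));
  rewrite ?rpred0 //.
by rewrite cE P0 // linear0.
Qed.

Lemma polarization_comm i j p q : polarization i j *m polarization p q -
  polarization p q *m polarization i j =
  (j == p)%:R *: polarization i q - (i == q)%:R *: polarization p j.
Proof. exact: (polar_mx_comm C (coef_exp_inj n_gt0) (coef_exp_deg n_gt0)
  (coef_exp_onto n_gt0) fam_exp_inj fam_exp_deg fam_exp_onto). Qed.

Lemma polarization_diag i : polarization i i = diag_mx (\row_b (weight_of expo
  (fam_exp b) i)%:R).
Proof. exact: (polar_mx_diag C (coef_exp_inj n_gt0) fam_exp_inj). Qed.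

Lemma weight_deg b : mdeg (weight_of expo (fam_exp b)) = (k * d)%N.
Proof. by rewrite (mdeg_weight_of (coef_exp_deg n_gt0)) fam_exp_deg mulnC. Qed.

Definition dcoords (P : dhomog N C k) : 'rV[C]_#|families| := coords fam_exp
  (val P).

Lemma dcoords_is_linear : linear dcoords.
Proof. by move=> c P Q; rewrite -linearP. Qed.
HB.instance Definition _ := GRing.isLinear.Build _ _ _ _ dcoords
  dcoords_is_linear.

Lemma dcoords_inj : injective dcoords.
Proof. by move=> P Q /(coords_inj fam_exp_inj fam_exp_deg fam_exp_onto (valP P)
  (valP Q)) /val_inj. Qed.

Lemma dcoords_onto w : exists P, dcoords P = w.
Proof.
have Qk : \sum_b w 0 b *: 'X_[fam_exp b] \is k.-homog.
  by apply: rpred_sum => b _; apply: rpredZ; rewrite dhomogX /= fam_exp_deg.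
exists (DHomog Qk); apply/rowP => b; rewrite mxE /= raddf_sum (bigD1 b) //=.
rewrite mcoeffZ mcoeffX eqxx mulr1 big1 ?addr0 // => c cb.
by rewrite mcoeffZ mcoeffX (inj_eq fam_exp_inj) (negbTE cb) mulr0.
Qed.

Lemma nu_rank (B : 'M[C]_#|families|) :
  (forall v : 'rV_#|families|, (v <= B)%MS <-> forall i j : 'I_n, i != j ->
    v *m polarization i j = 0) ->
  nu R n d k = \rank B.
Proof.
move=> BP; apply: (@dim_rank _ _ _ dcoords);
  [exact: dcoords_inj|exact: dcoords_onto|].
by move=> P; rewrite BP; apply: invariants_coords.
Qed.

Lemma nu_count m : (k * d = n * m)%N -> (nu R n d k)%:R = \sum_(p : 'S_n) (-1)
  ^+ p *
   #|[set al in families | (fam_weight al + rho_perm p)%MM == rho_shift n m]|%:R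
     :> C.
Proof.
move=> kdm; have deg b : mdeg (weight_of expo (fam_exp b)) = (n * m)%N by
  rewrite weight_deg.
have [B [BP rankB]] := @invariant_rank C n _ m _ polarization (fischer C expo
  fam_exp) polarization_comm polarization_diag deg
  (fischer_gt0 C expo fam_exp) (polar_mx_adj C expo fam_exp).
rewrite (nu_rank (B := B)) => [|v].
  rewrite {}rankB; apply: eq_bigr => p _; congr (_ * _%:R).
  rewrite -(card_imset _ (@enum_val_inj _ (mem families)));
    apply: eq_card => al.
  apply/imsetP/idP => [[b]|].
    rewrite !inE /fam_exp fam_weightE => bp ->; rewrite bp andbT.
    by have := enum_valP b; rewrite inE.
  rewrite inE => /andP [alP wal]; exists (enum_rank_in alP al).
    by rewrite inE /fam_exp enum_rankK_in // fam_weightE.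
  by rewrite enum_rankK_in.
rewrite BP; split=> v0 i j.
  move=> ij; move: (v0 i j); rewrite /twist (negbTE ij) muln0 mulmxBr => /eqP.
  by rewrite mul_mx_scalar scale0r subr0 => /eqP.
have [<-|ij] := eqVneq i j; last first.
  by rewrite /twist (negbTE ij) muln0 mulmxBr mul_mx_scalar scale0r subr0 v0.
apply/eqP; rewrite /twist mulmxBr mul_mx_scalar eqxx muln1.
have nC : n%:R != 0 :> C by rewrite pnatr_eq0 -lt0n.
rewrite -(inj_eq (scalerI nC)) scaler0 scalerBr.
rewrite (@offdiag_trace _ _ _ (n * m) _ polarization_comm _ v i v0) ?natrM
  ?scalerA ?subrr //.
by rewrite (sum_E polarization_diag deg) natrM.
Qed.

(** All [E i i] act on an invariant as the scalar k d / n, but the weights are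
    integral. *)
Lemma nu_eq0 : ~~ (n %| k * d)%N -> nu R n d k = 0%N.
Proof.
move=> ndiv; rewrite (nu_rank (B := 0)) ?mxrank0 // => v; split=> [|v0].
  by rewrite submx0 => /eqP -> i j _; rewrite mul0mx.
rewrite submx0; apply/eqP/rowP => b; rewrite mxE; apply/eqP/negPn/negP => vb.
have i0 : 'I_n := Ordinal n_gt0.
have /rowP/(_ b) := offdiag_trace polarization_comm (sum_E polarization_diag
  weight_deg) i0 v0.
rewrite polarization_diag mul_mx_diag !mxE mulrCA mulrC => /(mulIf vb)/eqP.
rewrite -natrM eqr_nat => /eqP h; case/negP: ndiv; rewrite -h.
exact: dvdn_mulr.
Qed.

End Count.

(** * The Weyl group as a group of permutations *)

Section Weyl.
Variable n' : nat.
Local Notation n := n'.+1.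
Local Notation eps := (eps_mx n).

Lemma mulmx_epsE (y : 'rV[int]_n) (r : 'I_n') :
  (y *m eps) 0 r = y 0 (widen_ord (leqnSn n') r) - y 0 (lift ord0 r).
Proof.
rewrite mxE; under eq_bigr do rewrite mxE mulrBr.
rewrite sumrB (bigD1 (widen_ord (leqnSn n') r)) //= eqxx mulr1 [X in _ + X -
  _]big1 ?addr0.
  rewrite (bigD1 (lift ord0 r)) //= eqxx mulr1 big1 ?addr0 // => i.
  by rewrite -val_eqE /= => /negbTE; rewrite /bump /= add1n => ->;
    rewrite mulr0.
by move=> i; rewrite -val_eqE /= => /negbTE ->; rewrite mulr0.
Qed.

Lemma eps_ker (y : 'rV[int]_n) : y *m eps = 0 -> forall i, y 0 i = y 0 ord0.
Proof.
move=> y0; suff h k (kn : (k < n)%N) : y 0 (Ordinal kn) = y 0 ord0.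
  by move=> [k kn]; apply: h.
elim: k kn => [|k IH] kn; first by congr (y 0 _); apply: val_inj.
rewrite -(IH (ltnW kn)); have kn' : (k < n')%N by [].
have /eqP := mulmx_epsE y (Ordinal kn'); rewrite y0 mxE eq_sym subr_eq0 => /eqP.
by move=> e; symmetry; apply: etrans (etrans _ e) _; congr (y 0 _);
  apply: val_inj.
Qed.

Lemma eps_const (c : int) : const_mx c *m eps = 0 :> 'rV_n'.
Proof. by apply/rowP => r; rewrite mulmx_epsE !mxE subrr. Qed.

Lemma mulmx_permE (y : 'rV[int]_n) (p : 'S_n) j : (y *m perm_mx p) 0 j = y 0
  ((p^-1)%g j).
Proof. by rewrite -[p in LHS]invgK -col_permE mxE. Qed.

(** Weights in fundamental coordinates are the images under [eps_mx] of
    weights of gl_n, whose coordinates are permuted by the Weyl group. *)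
Definition matches (p : 'S_n) (s : 'M[int]_n') := perm_mx p *m eps = eps *m s.

Lemma matches_inj p q s : matches p s -> matches q s -> p = q.
Proof.
rewrite /matches => ps qs; apply/permP => i; apply/eqP/negPn/negP => pq.
pose y : 'rV[int]_n := delta_mx 0 (p i) - delta_mx 0 (q i).
have y0 : y *m eps = 0.
  have rE (u : 'S_n) : delta_mx 0 (u i) *m eps = row i (perm_mx u *m eps) :>
    'rV_n'.
    by rewrite -rowE -row_permE; apply/rowP => j; rewrite !mxE.
  by rewrite mulmxBl !rE ps qs subrr.
have /eqP := etrans (eps_ker y0 (p i)) (esym (eps_ker y0 (q i))).
by rewrite !mxE !eqxx /= eq_sym (negbTE pq) [q i == p i]eq_sym (negbTE pq).
Qed.

(** The square matrix formed by a column of ones and [eps_mx] is regular, and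
    it conjugates the permutation matrix into the block matrix diag(1, s). *)
Lemma matches_det p s : matches p s -> \det s = (-1) ^+ p.
Proof.
move=> ps; pose Y : 'M[int]_(n, 1 + n') := row_mx (const_mx 1) eps.
have Y0 : \det (Y : 'M_n) != 0.
  apply/det0P => -[y yn0 yY]; case/negP: yn0.
  have : row_mx (y *m (const_mx 1 : 'cV_n)) (y *m eps) = row_mx 0 0.
    by rewrite -mul_mx_row row_mx0.
  move=> /eq_row_mx [/rowP/(_ 0) s0 /eps_ker yc].
  apply/eqP/rowP => i; rewrite yc mxE; apply/eqP.
  move/eqP: s0; rewrite !mxE; under eq_bigr do rewrite mxE mulr1 yc.
  by rewrite sumr_const card_ord mulrn_eq0.
have : perm_mx p *m Y = Y *m (block_mx 1%:M 0 0 s : 'M_(1 + n')).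
  rewrite /Y mul_mx_row [RHS]mul_row_block !mulmx0 addr0 add0r mulmx1 -ps;
    congr row_mx.
  by rewrite -row_permE; apply/matrixP => i j; rewrite !mxE.
move/(congr1 (fun Z : 'M_(n, 1 + n') => \det (Z : 'M_n))).
rewrite (det_mulmx (perm_mx p) (Y : 'M_n)) (det_mulmx (Y : 'M_n) (block_mx 1%:M
  0 0 s : 'M_(1 + n'))).
rewrite det_perm mulrC => /(mulfI Y0) ->; apply: esym.
by apply: etrans (det_ublock (1%:M : 'M_1) 0 s) _; rewrite det1 mul1r.
Qed.

Lemma matchesM p q s t : matches p s -> matches q t ->
  matches (p * q)%g (s *m t).
Proof.
by rewrite /matches perm_mxM -mulmxA => ps ->; rewrite mulmxA ps mulmxA.
Qed.

Lemma weylM (s t : 'M[int]_n') : weyl n s -> weyl n t -> weyl n (s *m t).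
Proof.
move=> sW tW; elim: sW => [|j s' _ IH]; first by rewrite mul1mx.
by rewrite -mulmxA; apply: in_weylM.
Qed.

Lemma matches_simple (r : 'I_n') :
  matches (tperm (widen_ord (leqnSn n') r) (lift ord0 r)) (simple_reflection (n
    := n) r).
Proof.
set a := widen_ord _ r; set b := lift ord0 r.
have ab : a != b by rewrite -val_eqE /= /bump /= add1n neq_ltn ltnSn.
rewrite /matches; apply/row_matrixP => i; rewrite !row_mul simple_reflectionE.
have rootE : simple_root (n := n) r = (delta_mx 0 a - delta_mx 0 b) *m eps.
  apply/rowP => l; rewrite mulmxBl -!rowE !mxE /= /bump /= add1n.
  rewrite -[r == l]val_eqE eqSS [l.+1 == r]eq_sym /=.
  case: (ltngtP r l) => [rl|lr|->]; last by rewrite (ltn_eqF (ltnSn l)) (gtn_eqF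
    (ltnSn l)).
    by rewrite (ltn_eqF (ltnW rl : (r < l.+1)%N)) orbF; case: eqP.
  by rewrite (gtn_eqF (ltnW lr : (l < r.+1)%N)) /=; case: eqP.
have -> : row i (perm_mx (tperm a b)) = delta_mx 0 (tperm a b i) :> 'rV[int]_n.
  by apply/rowP => j; rewrite !mxE eq_sym.
rewrite (rowE i eps) mulmx_epsE -/a -/b rootE scalemxAl -mulmxBl;
  congr (_ *m _).
rewrite !mxE /=; case: tpermP => [->|->|/eqP ia /eqP ib].
- by rewrite eqxx [b == a]eq_sym (negbTE ab) subr0 scale1r subKr.
- by rewrite eqxx (negbTE ab) sub0r scaleN1r opprK addrC subrK.
- by rewrite [a == i]eq_sym [b == i]eq_sym (negbTE ia) (negbTE ib) subrr scale0r
  subr0.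
Qed.

Lemma matches1 : matches 1 1%:M.
Proof. by rewrite /matches perm_mx1 mul1mx mulmx1. Qed.

(** Each permutation is a product of transpositions of neighbours, which match
    the simple reflections. *)
Lemma matches_onto p : exists2 s, weyl n s & matches p s.
Proof.
pose G q := exists2 s, weyl n s & matches q s.
have GM q q' : G q -> G q' -> G (q * q')%g.
  by move=> [s sW qs] [t tW qt]; exists (s *m t);
    [exact: weylM|exact: matchesM].
have Gadj (a b : 'I_n) : b = a.+1 :> nat -> G (tperm a b).
  move=> ab; have an' : (a < n')%N by have := ltn_ord b; rewrite ab.
  exists (simple_reflection (n := n) (Ordinal an')).
    by rewrite -[simple_reflection _]mulmx1; apply: in_weylM; apply: in_weyl1.
  suff -> : tperm a b = tperm (widen_ord (leqnSn n') (Ordinal an')) (lift ord0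
    (Ordinal an')).
    exact: matches_simple.
  by congr tperm; apply: val_inj => //=; rewrite ab.
have Glt k : forall a b : 'I_n, (b = a + k.+1 :> nat)%N -> G (tperm a b).
  elim: k => [|k IH] a b ab; first by apply: Gadj; rewrite ab addn1.
  have cn : (a + k.+1 < n)%N by apply: leq_ltn_trans (ltn_ord b); rewrite ab;
    lia.
  pose c := Ordinal cn.
  have -> : tperm a b = (tperm c b * tperm a c * tperm c b)%g.
    have := tpermJ a c (tperm c b); rewrite tpermL conjgE tpermV mulgA => ->.
    by rewrite tpermD // -val_eqE /=; lia.
  have Gcb : G (tperm c b) by apply: Gadj; rewrite ab /=; lia.
  exact: (GM _ _ (GM _ _ Gcb (IH a c erefl)) Gcb).
have Gt (a b : 'I_n) : a != b -> G (tperm a b).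
  case: (ltngtP a b) => [ab _|ba _|/val_inj ->]; last by rewrite eqxx.
    by apply: (Glt (b - a).-1); lia.
  by rewrite tpermC; apply: (Glt (a - b).-1); lia.
have [ts -> /allP tsP] := prod_tpermP p; rewrite big_seq.
elim/big_rec: _ => [|t q tin Gq]; first by exists 1%:M;
  [exact: in_weyl1|exact: matches1].
by apply: (GM) Gq; apply: Gt; apply: tsP.
Qed.

Lemma weyl_sum (f : 'M[int]_n' -> int) (g : 'S_n -> int) :
  (forall p s, weyl n s -> matches p s -> f s = g p) ->
  \sum_(s \in weyl n) f s = \sum_p g p.
Proof.
move=> fg; pose h p := sval (cid2 (matches_onto p)).
have hP p : weyl n (h p) /\ matches p (h p) by rewrite /h; case: cid2.
rewrite (reindex_fsbig h setT); last first.
  split=> [p _|p q _ _ pq|s sW]; first by case: (hP p).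
    by apply: matches_inj (hP p).2 _; rewrite pq; case: (hP q).
  have [p ps] := weyl_perm sW; exists p => //.
  by apply: (@eps_mx_inj n); rewrite -(hP p).2.
transitivity (\sum_(p <- index_enum _) g p) => //.
rewrite (@bigfs _ _ _ _ (index_enum _) predT g) ?index_enum_uniq //; last first.
  by move=> i _; rewrite mem_index_enum.
rewrite (_ : [set` predT]%classic = setT); last by apply/seteqP; split.
by apply: eq_fsbigr => p _; apply: fg; case: (hP p).
Qed.

End Weyl.

(** * Weights of families *)

Section Counting.
Variables (n' d k : nat).
Local Notation n := n'.+1.
Local Notation eps := (eps_mx n).
Local Notation fam := {ffun Ind n d -> 'I_k.+1}.

Definition weight_row (al : fam) : 'rV[int]_n := \row_i (fam_weight al i)%:Z.

Lemma fam_weight_lift (al : fam) (r : 'I_n') : fam_weight al (lift ord0 r) =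
  omega al r.
Proof.
rewrite mnm_sumE; apply: eq_bigr => i _.
by rewrite mulmnE mnmE /= -(mnm_nth 0%N).
Qed.

Lemma mdeg_fam_weight (al : fam) : mdeg (fam_weight al) = (d * \sum_i al i)%N.
Proof.
rewrite mdeg_sum big_distrr; apply: eq_bigr => i _ /=.
by rewrite mdegMn mdeg_form_mon.
Qed.

Lemma fam_weight0 (al : fam) : (fam_weight al ord0 + \sum_r omega al r = d *
  \sum_i al i)%N.
Proof.
rewrite -mdeg_fam_weight mdegE big_ord_recl; congr (_ + _)%N.
by apply: eq_bigr => r _; rewrite fam_weight_lift.
Qed.

(** The defining equations of c_{n,d} are the coordinates of one equation of
    weights; the first of them has been rewritten with the total weight k d. *)
Lemma c_numE (mu : weight n) :
  c_num n d k mu = #|[set al in families n d k | weight_row al *m eps == mu]|.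
Proof.
apply: eq_card => al; rewrite !inE.
have [alk|] := eqVneq; last by rewrite !andbF.
rewrite !andbT; have w0 := fam_weight0 al; rewrite alk in w0.
have first_coord (r : 'I_n') : r = 0%N :> nat ->
    ((2 * omega al r + \sum_(t < n' | (0 < t)%N) omega al t)%N%:Z == (k *
      d)%N%:Z - mu 0 r) =
    ((weight_row al *m eps) 0 r == mu 0 r).
  move=> r0; rewrite mulmx_epsE !mxE fam_weight_lift.
  have -> : widen_ord (leqnSn n') r = ord0 by apply: val_inj.
  have sumE : (\sum_t omega al t = omega al r + \sum_(t < n' | (0 < t)%N) omega
    al t)%N.
    rewrite (bigD1 r) //=; congr (_ + _)%N; apply: eq_bigl => t.
    by rewrite -val_eqE /= r0 lt0n.
  by move: w0; rewrite sumE; set a := fam_weight _ _; set b := omega _ _;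
    set c := (\sum_(t | _) _)%N; lia.
have next_coord (r t : 'I_n') : t = r.+1 :> nat ->
    ((omega al r)%:Z - (omega al t)%:Z == mu 0 t) = ((weight_row al *m eps) 0 t
      == mu 0 t).
  move=> tr; rewrite mulmx_epsE !mxE fam_weight_lift.
  have -> : widen_ord (leqnSn n') t = lift ord0 r by apply: val_inj;
    rewrite /= tr.
  by rewrite fam_weight_lift.
apply/andP/eqP => [[/forallP h0 /forallP h1]|wmu].
  apply/rowP => r; apply/eqP; case: r => -[|r] rn.
    by rewrite -first_coord //; have := h0 (Ordinal rn).
  rewrite -(next_coord (Ordinal (ltnW rn))) //.
  by have /forallP/(_ (Ordinal rn)) := h1 (Ordinal (ltnW rn)); rewrite eqxx.
split; apply/forallP => r; first by apply/implyP => /eqP /first_coord ->;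
  rewrite wmu.
by apply/forallP => t; apply/implyP => /eqP /next_coord ->; rewrite wmu.
Qed.

Lemma ind_perm_ex (q : 'S_n) (i : Ind n d) :
  exists j : Ind n d, form_mon j == [multinom form_mon i (q r) | r < n].
Proof.
have deg : mdeg [multinom form_mon i (q r) | r < n] = d.
  rewrite -[RHS](@mdeg_form_mon n d i) // !mdegE [RHS](reindex_inj (@perm_inj _
    q)).
  by apply: eq_bigr => r _; rewrite mnmE.
by have [j <-] := form_mon_onto (ltn0Sn n') deg; exists j.
Qed.

Definition ind_perm (q : 'S_n) (i : Ind n d) : Ind n d := xchoose (ind_perm_ex q
  i).

Lemma ind_permE q i r : form_mon (ind_perm q i) r = form_mon i (q r).
Proof. by rewrite (eqP (xchooseP (ind_perm_ex q i))) mnmE. Qed.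

Lemma ind_perm_inj q : injective (ind_perm q).
Proof.
move=> i j ij; apply: (@form_mon_inj n d) => //; apply/mnmP => r.
by rewrite -[r](permKV q) -!ind_permE ij.
Qed.

(** Permuting the variables of forms permutes the families, so the weight
    multiplicities are invariant under the Weyl group. *)
Lemma fam_count_perm (q : 'S_n) (y : 'rV[int]_n') :
  #|[set al in families n d k | weight_row al *m eps == y]| =
  #|[set al in families n d k | weight_row al *m perm_mx q *m eps == y]|.
Proof.
pose f (al : fam) : fam := [ffun i => al (ind_perm q i)].
have f_inj : injective f.
  move=> al be /ffunP e; apply/ffunP => i.
  have [g _ gK] := injF_bij (@ind_perm_inj q).
  by have := e (g i); rewrite !ffunE gK.
have f_sum al : (\sum_i f al i = \sum_i al i)%N.
  rewrite [RHS](reindex_inj (@ind_perm_inj q)).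
  by apply: eq_bigr => i _; rewrite ffunE.
have f_weight al : weight_row (f al) = weight_row al *m perm_mx q.
  apply/rowP => r; rewrite mulmx_permE !mxE; congr Posz.
  rewrite !mnm_sumE [RHS](reindex_inj (@ind_perm_inj q)); apply: eq_bigr => i _.
  by rewrite !mulmnE ind_permE permKV ffunE.
rewrite -(card_preimset [set al in _ | _ al *m eps == y] f_inj).
by apply: eq_card => al; rewrite !inE f_weight f_sum.
Qed.

Lemma fam_count_orbit p s (y : 'rV[int]_n) : matches p s ->
  #|[set al in families n d k | weight_row al *m eps == y *m perm_mx p *m eps]|
    =
  #|[set al in families n d k | weight_row al *m eps == y *m eps]|.
Proof.
move=> ps; rewrite (fam_count_perm p); apply: eq_card => al; rewrite !inE.
congr (_ && _); rewrite -![_ *m perm_mx p *m eps]mulmxA ps !mulmxA.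
have us : s \in unitmx by rewrite unitmxE (matches_det ps) unitrX // unitrN1.
exact: (inj_eq (can_inj (mulmxK us))).
Qed.

(** Sort the coordinates of the weight of gl_n in decreasing order. *)
Lemma dominant_ex (y : 'rV[int]_n) :
  exists mu : weight n, dominant mu /\ exists2 s, weyl n s & mu = y *m eps *m s.
Proof.
pose t := [tuple y 0 i | i < n].
have /tuple_permP [p tp] : perm_eq (sort >=%R t) t by rewrite perm_sort.
have [s sW ps] := matches_onto p^-1%g.
exists (y *m eps *m s); split; last by exists s.
move=> j; rewrite -mulmxA -ps mulmxA mulmx_epsE !mulmx_permE invgK subr_ge0.
have sorted_t : sorted >=%R (sort >=%R t) by apply: sort_sorted => a b;
  exact: le_total.
have nthE (i : 'I_n) : nth 0 (sort >=%R t) i = y 0 (p i).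
  by rewrite tp -tnth_nth !tnth_mktuple.
have := sorted_leq_nth ge_trans ge_refl 0 sorted_t.
move=> /(_ (widen_ord (leqnSn n') j) (lift ord0 j)).
rewrite !nthE; apply; rewrite ?inE ?tp ?size_tuple //=;
  last exact: (ltn_ord (lift ord0 j)).
exact: (ltn_ord (widen_ord (leqnSn n') j)).
Qed.

Lemma c_num_dominant (y : 'rV[int]_n) : c_num n d k (dominant_rep (n := n) (y *m
  eps)) =
  #|[set al in families n d k | weight_row al *m eps == y *m eps]|.
Proof.
have [_ [s sW muE]] := xgetPex (0 : weight n) (dominant_ex y).
have {}muE : dominant_rep (n := n) (y *m eps) = y *m eps *m s := muE.
rewrite muE.
have [p ps] := weyl_perm sW.
by rewrite c_numE -(fam_count_orbit y ps) -!mulmxA ps.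
Qed.

(** The vector of [rho_perm] as a weight of gl_n; the order of its entries is
    opposite to that of rho, whence the sign in [rho_rowE]. *)
Definition rho_row : 'rV[int]_n := \row_i (i%:Z).

Lemma rho_rowE : rho n = - (rho_row *m eps).
Proof.
by apply/rowP => r; rewrite [RHS]mxE mulmx_epsE !mxE /= /bump /= add1n; lia.
Qed.

Lemma rho_diff p s : matches p s ->
  rho n - rho n *m s = (rho_row - rho_row *m perm_mx p^-1) *m perm_mx p *m eps.
Proof.
move=> ps; rewrite rho_rowE mulNmx -[rho_row *m eps *m s]mulmxA -ps mulmxA opprK
  addrC -mulmxBl.
by congr (_ *m _); rewrite mulmxBl -mulmxA -perm_mxM mulVg perm_mx1 mulmx1.
Qed.

(** The kernel of [eps_mx] consists of the constant vectors, and the constant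
    is determined by the total weight k d. *)
Lemma fam_const (al : fam) p : al \in families n d k ->
  weight_row al *m eps = (rho_row - rho_row *m perm_mx p^-1) *m eps <->
  exists2 c : int, (k * d)%:Z = n%:Z * c & forall i,
    (fam_weight al i)%:Z + (p i : nat)%:Z = i%:Z + c.
Proof.
rewrite inE => /eqP alk; set z := rho_row - _.
have zE i : z 0 i = i%:Z - (p i : nat)%:Z.
  by rewrite [LHS]mxE [X in _ + X]mxE mulmx_permE invgK !mxE.
split=> [eq_eps|[c _ cE]]; last first.
  apply/eqP; rewrite -subr_eq0 -mulmxBl (_ : _ - z = const_mx c) ?eps_const //.
  by apply/rowP => i; rewrite mxE [weight_row al 0 i]mxE mxE zE mxE;
    have := cE i; lia.
have /eps_ker xc : (weight_row al - z) *m eps = 0 by rewrite mulmxBl eq_eps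
  subrr.
pose c := (weight_row al - z) 0 ord0.
have cE i : (fam_weight al i)%:Z + (p i : nat)%:Z = i%:Z + c.
  by have := xc i; rewrite -/c mxE [weight_row al 0 i]mxE mxE zE; lia.
exists c => //.
have sumE : \sum_(i < n) ((fam_weight al i)%:Z + (p i : nat)%:Z) = \sum_(i < n)
  (i%:Z + c) :> int.
  by apply: eq_bigr => i _; rewrite cE.
move: sumE; rewrite !big_split /= sumr_const card_ord.
have -> : \sum_(i < n) (p i : nat)%:Z = \sum_(i < n) (i : nat)%:Z :> int.
  by rewrite [RHS](reindex_inj (@perm_inj _ p)).
rewrite addrC => /addrI; rewrite -[_ *+ _]mulr_natl natz => <-.
have natE (f : 'I_n -> nat) : (\sum_i f i)%N%:Z = \sum_i (f i)%:Z :> int.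
  by elim/big_rec2: _ => // i x y _ <-.
by rewrite -natE -mdegE mdeg_fam_weight alk mulnC.
Qed.

Lemma c_num_count p s m : matches p s -> (k * d = n * m)%N ->
  c_num n d k (dominant_rep (rho n - rho n *m s)) =
  #|[set al in families n d k | (fam_weight al + rho_perm p)%MM == rho_shift n
    m]|.
Proof.
move=> ps kdm; rewrite (rho_diff ps) c_num_dominant (fam_count_orbit _ ps).
apply: eq_card => al; rewrite !inE; case: (boolP (_ == k)) => //= alk.
have alP : al \in families n d k by rewrite inE.
apply/eqP/eqP => [/(fam_const p alP) [c kc cE]|mE].
  apply/mnmP => i; rewrite mnmDE !mnmE; have := cE i.
  have -> : c = m%:Z; last by lia.
  by move: kc; rewrite kdm PoszM => /mulfI ->.
apply/(fam_const p alP); exists m%:Z => [|i]; first by rewrite kdm PoszM.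
by move/mnmP/(_ i): mE; rewrite mnmDE !mnmE; lia.
Qed.

Lemma c_num_eq0 p s : matches p s -> ~~ (n %| k * d)%N ->
  c_num n d k (dominant_rep (rho n - rho n *m s)) = 0%N.
Proof.
move=> ps ndiv; rewrite (rho_diff ps) c_num_dominant (fam_count_orbit _ ps).
apply: eq_card0 => al; rewrite !inE; apply/negP => /andP [alk /eqP].
have alP : al \in families n d k by rewrite inE.
move/(fam_const p alP) => [c kc _]; case/negP: ndiv.
by apply/dvdnP; exists `|c|%N; apply: etrans (congr1 absz kc) _;
  rewrite abszM mulnC.
Qed.

End Counting.

Theorem theorem1 (R : realType) (n d k : nat) (hn : (2 <= n)%N)
    (hd : (1 <= d)%N) :
  (nu R n d k)%:Z =
    \sum_(s \in weyl n)
      \det s * (c_num n d k (dominant_rep (rho n - rho n *m s)))%:Z.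
Proof.
case: n hn => // n' _.
have [/dvdnP [m kdm]|ndiv] := boolP (n'.+1 %| k * d)%N; last first.
  rewrite (weyl_sum (g := fun=> 0)) => [|p s _ ps]; last first.
    by rewrite (c_num_eq0 ps ndiv) mulr0.
  by rewrite nu_eq0 // big1.
rewrite [RHS]mulnC in kdm.
rewrite (weyl_sum (g := fun p : 'S_n'.+1 => (-1) ^+ p *
   #|[set al in families n'.+1 d k | (fam_weight al + rho_perm p)%MM ==
     rho_shift n'.+1 m]|%:Z)).
  apply: (@intr_inj R[i]); rewrite rmorph_sum /= -pmulrn (nu_count _ (ltn0Sn n')
    kdm).
  by apply: eq_bigr => p _; rewrite rmorphM rmorphXn rmorphN1 /= -pmulrn.
by move=> p s _ ps; rewrite (matches_det ps) (c_num_count ps kdm).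
Qed.
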